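(* Let $\mathbb K$ be a field and $\mathbb P=\mathbb K[x_1,\dots,x_n]$. The algorithms TRB-F5, TRB-EF5 (with either of its two signature orders) and TRB-GVW are regular TRB algorithms; that is, in each of them every output of the reduction function is top irreducible by all pairs, and for every admitted input $f=(f_1,\dots,f_d)$, when the algorithm terminates, every TRB pair is equivalent to a pair stored in $DONE$.
   Context: Basic notions. $M$ is the set of monomials of $\mathbb P$; a monomial of $\mathbb P^d$ is $mE_i$ with $m\in M$ and $E_i$ the $i$-th unit vector; $s\mid s'$ for monomials of $\mathbb P^d$ means $s'=ms$ for some $m\in M$. $\prec_m$, $\prec_s$ are admissible orders on $\mathbb P$, $\mathbb P^d$ (total orders on monomials compatible with multiplication by $M$, with $1\prec_m m$ for $1\ne m\in M$, resp. $s\prec_s ms$). Conventionally $lm(0)=0$ and $0$ is smaller than every monomial. Leading monomials/terms/coefficients are taken with respect to $\prec_m$ on $\mathbb P$ and $\prec_s$ on $\mathbb P^d$. Given $f=(f_1,\dots,f_d)\in\mathbb P^d$, a pair is $p=(u,v)\in\mathbb P^d\times\mathbb P$ with $u\cdot f=v$; $lm(p)=lm(v)$, $lt(p)=lt(v)$, $sig(p)=lm(u)$. $(u_1,v_1)\prec_p(u_2,v_2)$ iff $lm(v_1)lm(u_2)\prec_s lm(v_2)lm(u_1)$. $p_1\equiv p_2$ (equivalent) iff $sig(p_1)=sig(p_2)$ and $lm(p_1)=lm(p_2)$. $p_1\sim p_2$ (similar) iff $lm(p_1)sig(p_2)=lm(p_2)sig(p_1)$. $p$ is syzygy if $lm(p)=0$;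 a signature is syzygy if it is the signature of a syzygy pair. $p_1$ is top reducible by $p_2$ if both are non-syzygy, $p_1\prec_p p_2$ and $lm(p_2)\mid lm(p_1)$; the top reduction replaces $p_1$ by $p_1-\frac{lt(p_1)}{lt(p_2)}p_2$. A non-syzygy pair that cannot be top reduced by any pair is a TRP pair. The TRP similar set of $p$ is the set of all TRP pairs similar to $p$. A TRB pair is a TRP pair $p'$ such that $sig(p')$ is not properly divisible by any signature of a pair in the same TRP similar set. Multiplied pairs. A multiplied pair $[m,p]$ is an element of $M\times PAIR$ ($PAIR$ the set of all pairs); its value is $mp$ and $sig([m,p])=sig(mp)$. $p_1$ is top reducible by $[m,p]$ if $p_1$ is top reducible by $p$ and $lm(p_1)=lm(mp)$. For two non-similar non-syzygy pairs $p_1,p_2$, their J-pair is $[m,p]$ with $p$ the $\prec_p$-smaller of $p_1,p_2$ and $m=lcm(lm(p_1),lm(p_2))/lm(p)$. TRB algorithm. Input $f$. Step 0: $DONE:=\emptyset$, $TODO:=\{[1,(E_i,f_i)]: i=1,\dots,d\}$ (the initial multiplied pairs). Step 1: if $TODO=\emptyset$ output $DONE$; otherwise select (and remove from $TODO$) a multiplied pair $[m,p]$ with smallest signature with respect to $\prec_s$. Step 2: if $Criterions([m,p])$ is true (some criterion is met), go to Step 1; otherwise put $p':=Reductions(mp)$, where $Reductions$ is a composition of top reductions whose output must be top irreducible by any pair. Step 3: if $CheckStore(p')$ is true, add to $TODO$ all J-pairs of $p'$ with $p''\in DONE$ (none if the two pairs are similar or one is syzygy), and then add $p'$ to $DONE$;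 go to Step 1. $CheckStore$ blocks $p'$ if $p'$ is non-initial and equivalent to the input $mp$ of the corresponding $Reductions$. A TRB algorithm is regular if for every input $f$, when the algorithm terminates, every TRB pair is, up to equivalence, in $DONE$. A multiplied pair passes criterions if it meets none of them. TRB-F5. Inputs are homogeneous polynomials, $\prec_m$ is a homogeneous (degree-compatible) order, and $x^\alpha E_i\prec_s x^\beta E_j$ iff $i>j$, or $i=j$ and $x^\alpha\prec_m x^\beta$. $index(p)=i$ if $sig(p)=x^\alpha E_i$; $deg(p)=|\alpha|$ if $lm(p)=x^\alpha$. $p_1\prec_{F5}p_2$ iff $index(p_1)>index(p_2)$, or the indices are equal and $deg(p_1)<deg(p_2)$ (for multiplied pairs, applied to values). $F5Criterions$ consists of two criteria. Syzygy Criterion: $[m,p]$ meets it if there is $p_1=(u_1,v_1)\in DONE$ with $i=index(p)<index(p_1)$ and $lm(v_1)E_i\mid sig(mp)$. Rewritten Criterion: a list Rules, initially empty, is kept; before every selection in Step 1, each $[m,p]\in TODO$ that has the smallest $\prec_{F5}$ order in $TODO$ and passes $F5Criterions$ is replaced in $TODO$ by $[1,mp]$, and $mp$ is prepended at the head of Rules; after $mp$ has been reduced, $mp$ in Rules is replaced by $F5Reductions(mp)$. If $p'$ is the first pair in Rules whose signature divides $sig(mp)$, then $[m,p]$ meets the Rewritten Criterion if $p\neq p'$. $p_1$ is F5 reducible by $[m_2,p_2]$ if it is top reducible by $[m_2,p_2]$ and $[m_2,p_2]$ passes $F5Criterions$; $F5Reductions$ performs F5 reductions by $DONE$ until the result cannot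 be F5 reduced by $DONE$. $CheckStore$ is the general one. TRB-EF5. Same as TRB-F5 (homogeneous polynomials, homogeneous order $\prec_m$, $F5Reductions$ and $CheckStore$), except that $F5Criterions$ is replaced everywhere by $EF5Criterions$, no pairs in $TODO$ are replaced, and $\prec_s$ is one of the following two orders: (a) $x^\alpha E_i\prec_s x^\beta E_j$ iff $lm(x^\alpha f_j)\prec_m lm(x^\beta f_i)$, or $lm(x^\alpha f_j)=lm(x^\beta f_i)$ and $lm(f_j)\prec_m lm(f_i)$; (b) $x^\alpha E_i\prec_s x^\beta E_j$ iff $deg(x^\alpha f_i)<deg(x^\beta f_j)$, or these degrees are equal and $x^\alpha\prec_m x^\beta$, or these degrees are equal, $x^\alpha=x^\beta$ and $i<j$ (for inputs $f$ for which the formula defines an admissible order). $EF5Criterions$: $[m,p]$ meets the ESyzygy Criterion if $sig(mp)$ is divisible by some $lm(q)E_i$ with $q\in DONE$ and $(E_i,f_i)\prec_p q$; it meets the ERewritten Criterion iff there is $p'\in DONE$ with $sig(p')\mid sig(mp)$ and $sig(p')\succ_s sig(p)$. TRB-GVW. $\prec_m$, $\prec_s$ are arbitrary admissible orders. $GVWCriterions$: $[m,p]$ meets the GSyzygy Criterion if $sig(mp)$ is divisible by a signature in Syzygies, which consists of all syzygy signatures in $DONE$ and all $\max(sig(v_2p_1),sig(v_1p_2))$ with $p_i=(u_i,v_i)\in DONE$ and $sig(v_2p_1)\neq sig(v_1p_2)$; it meets the Signature Criterion if another multiplied pair with the same signature $sig(mp)$ has already passed this function. Reductions is $TopReductions$: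 top reductions by $DONE$ until the result cannot be top reduced by $DONE$. $CheckStore$ blocks $p$ iff $p\equiv m_1p_1$ for some $[m_1,p_1]\in M\times DONE$. *)

(* Defs.v *)
From Stdlib Require Import Relation_Operators.
From mathcomp Require Import all_boot all_order all_algebra.
From mathcomp Require Import finmap.
From mathcomp Require Import mpoly.

Set Implicit Arguments.
Unset Strict Implicit.
Unset Printing Implicit Defensive.

Import GRing.Theory.

Local Open Scope ring_scope.
Local Open Scope fset_scope.

(* A monomial of P is m : 'X_{1..n} (written additively: 1 is 0%MM,
   the product is (_ + _)%MM, divisibility is (_ <= _)%MM); the monomial m E_i
   of P^d is the pair (m, i).  A leading monomial is an option, None standing
   for the conventional value lm(0) = 0.  Orders are given by their strict
   part.  Indices of 'I_d start at 0 instead of 1. *)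
Notation smon n d := ('X_{1..n} * 'I_d)%type.

Section Monomials.
Context {n d : nat}.
Implicit Types (m : 'X_{1..n}) (s : smon n d).

Definition smul m s : smon n d := ((m + s.1)%MM, s.2).

Definition sdvd s s' : bool := (s.2 == s'.2) && (s.1 <= s'.1)%MM.

Definition admissible_mon (r : rel 'X_{1..n}) : Prop :=
  [/\ irreflexive r, transitive r,
      forall m1 m2, m1 != m2 -> r m1 m2 || r m2 m1,
      forall m m1 m2, r m1 m2 -> r (m + m1)%MM (m + m2)%MM
    & forall m, m != 0%MM -> r 0%MM m].

Definition admissible_smon (r : rel (smon n d)) : Prop :=
  [/\ irreflexive r, transitive r,
      forall s1 s2, s1 != s2 -> r s1 s2 || r s2 s1,
      forall m s1 s2, r s1 s2 -> r (smul m s1) (smul m s2)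
    & forall m s, m != 0%MM -> r s (smul m s)].

Definition homogeneous_order (r : rel 'X_{1..n}) : Prop :=
  forall m1 m2, (mdeg m1 < mdeg m2)%N -> r m1 m2.

Definition osmul (x : option 'X_{1..n}) (y : option (smon n d)) :
    option (smon n d) :=
  if (x, y) is (Some m, Some s) then Some (smul m s) else None.

(* 0 divides only 0, and no nonzero monomial divides 0 with a monomial
   quotient: s' = m s with m in M. *)
Definition odvd (x y : option 'X_{1..n}) : bool :=
  match x, y with
  | Some m, Some m' => (m <= m')%MM
  | None, None => true
  | _, _ => false
  end.

Definition osdvd (x y : option (smon n d)) : bool :=
  match x, y with
  | Some s, Some s' => sdvd s s'
  | None, None => true
  | _, _ => false
  end.

End Monomials.

Definition olt (T : Type) (r : rel T) (x y : option T) : bool :=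
  match x, y with
  | None, Some _ => true
  | Some a, Some b => r a b
  | _, None => false
  end.

Definition omax (T : Type) (r : rel T) (x y : option T) : option T :=
  if olt r x y then y else x.

(* Elements (u, v) of P^d * P; they are pairs in the sense of the signature
   algorithms when is_pair f holds. *)
Notation pair_t K n d := ('rV[{mpoly K[n]}]_d * {mpoly K[n]})%type.
Notation mpair_t K n d := ('X_{1..n} * pair_t K n d)%type.

Section Pairs.
Context {K : fieldType} {n d : nat}.
Notation P := {mpoly K[n]}.
Notation pair := (pair_t K n d).
Notation mpair := (mpair_t K n d).
Variables (ltm : rel 'X_{1..n}) (lts : rel (smon n d)) (f : 'I_d -> P).
Implicit Types (v : P) (u : 'rV[P]_d) (p q : pair) (x : mpair).

Definition lm v : option 'X_{1..n} :=
  \big[omax ltm/None]_(m <- msupp v) Some m.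

Definition lmv u : option (smon n d) :=
  \big[omax lts/None]_(i < d) \big[omax lts/None]_(m <- msupp (u 0 i)) Some (m, i).

Definition is_pair p : Prop := \sum_(i < d) p.1 0 i * f i = p.2.

Definition sig p := lmv p.1.

Definition initial_pair (i : 'I_d) : pair := (delta_mx 0 i, f i).

Definition pscale (c : P) p : pair := (c *: p.1, c * p.2).

Definition nonsyzygy p : bool := lm p.2 != None.

Definition pair_lt p1 p2 : bool :=
  olt lts (osmul (lm p1.2) (sig p2)) (osmul (lm p2.2) (sig p1)).

Definition equivp p1 p2 : bool := (sig p1 == sig p2) && (lm p1.2 == lm p2.2).

Definition similar p1 p2 : bool :=
  osmul (lm p1.2) (sig p2) == osmul (lm p2.2) (sig p1).

Definition top_reducible p1 p2 : bool :=
  [&& nonsyzygy p1, nonsyzygy p2, pair_lt p1 p2 & odvd (lm p2.2) (lm p1.2)].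

(* lt(v1) / lt(v2), when lm(v2) divides lm(v1) *)
Definition lt_quot v1 v2 : P :=
  if (lm v1, lm v2) is (Some m1, Some m2)
  then (v1@_m1 / v2@_m2) *: 'X_[(m1 - m2)%MM] else 0.

Definition top_reduction p1 p2 : pair := p1 - pscale (lt_quot p1.2 p2.2) p2.

Definition top_irreducible p : Prop :=
  forall q, is_pair q -> ~~ top_reducible p q.

Definition TRP_pair p : Prop :=
  [/\ is_pair p, nonsyzygy p & top_irreducible p].

Definition TRB_pair p : Prop :=
  TRP_pair p /\
  forall q, TRP_pair q -> similar q p ->
    ~~ (osdvd (sig q) (sig p) && (sig q != sig p)).

Definition value x : pair := pscale 'X_[x.1] x.2.

Definition msig x := sig (value x).

Definition top_reducible_mul p1 x : bool :=
  top_reducible p1 x.2 && (lm p1.2 == lm (value x).2).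

Definition jpair p1 p2 : option mpair :=
  if (lm p1.2, lm p2.2) is (Some m1, Some m2) then
    if similar p1 p2 then None
    else if pair_lt p1 p2 then Some ((mlcm m1 m2 - m1)%MM, p1)
    else Some ((mlcm m1 m2 - m2)%MM, p2)
  else None.

Definition jpairs p (D : {fset pair}) : {fset mpair} :=
  [fset x in pmap (jpair p) D].

Definition composed_of_top_reductions p q : Prop :=
  clos_refl_trans pair
    (fun p1 p2 => exists r,
       [/\ is_pair r, top_reducible p1 r & p2 = top_reduction p1 r]) p q.

Record state (A : Type) := State {
  DONE : {fset pair}; TODO : {fset mpair}; memo : A }.

(* The parts in which the TRB algorithms differ:
   - prepare relates the state before and after the treatment that precedes a
     selection in Step 1;
   - reductions s p q: Reductions(p) may return q in state s;
   - blocks s x q: CheckStore blocks the result q of reducing the value of x;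
   - update s x q: the further data once x has passed the criterions and its
     value has been reduced to q. *)
Record algorithm := Algorithm {
  memory : Type;
  memory0 : memory;
  prepare : state memory -> state memory -> Prop;
  criterions : state memory -> mpair -> bool;
  reductions : state memory -> pair -> pair -> Prop;
  blocks : state memory -> mpair -> pair -> Prop;
  update : state memory -> mpair -> pair -> memory }.

Section Execution.
Variable A : algorithm.
Implicit Types s : state (memory A).

Definition initial_state : state (memory A) :=
  State fset0 [fset (0%MM, initial_pair i) | i in 'I_d] (memory0 A).

Definition selects s x : Prop :=
  x \in TODO s /\ forall y, y \in TODO s -> ~~ olt lts (msig y) (msig x).

(* From state s, after preparation into s1, the multiplied pair x is selected
   and passes the criterions, and Reductions returns q on its value. *)
Definition reduces_to s s1 x q : Prop :=
  [/\ prepare s s1, selects s1 x, ~~ criterions s1 x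
    & reductions s1 (value x) q].

Inductive step s : state (memory A) -> Prop :=
| step_criterion s1 x of prepare s s1 & selects s1 x & criterions s1 x :
    step s (State (DONE s1) (TODO s1 `\ x) (memo s1))
| step_blocked s1 x q of reduces_to s s1 x q & blocks s1 x q :
    step s (State (DONE s1) (TODO s1 `\ x) (update s1 x q))
| step_store s1 x q of reduces_to s s1 x q & ~ blocks s1 x q :
    step s (State (q |` DONE s1)
                  ((TODO s1 `\ x) `|` jpairs q (DONE s1))
                  (update s1 x q)).

Definition reachable s : Prop :=
  clos_refl_trans (state (memory A)) step initial_state s.

Definition is_TRB_algorithm : Prop :=
  forall s s1 x q, reachable s -> reduces_to s s1 x q ->
    composed_of_top_reductions (value x) q /\ top_irreducible q.

Definition is_regular : Prop :=
  forall s, reachable s -> TODO s = fset0 ->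
    forall p, TRB_pair p -> exists2 q, q \in DONE s & equivp p q.

Definition regular_TRB_algorithm : Prop := is_TRB_algorithm /\ is_regular.

End Execution.

(* Top reductions by those [m, p] with p in D for which ok [m, p] holds,
   until none is possible. *)
Definition reduction_step (ok : pred mpair) (D : {fset pair}) p q : Prop :=
  exists x, [/\ x.2 \in D, top_reducible_mul p x, ok x
              & q = top_reduction p x.2].

Definition exhaustive_reduction (ok : pred mpair) (D : {fset pair}) p q :
    Prop :=
  clos_refl_trans pair (reduction_step ok D) p q /\
  forall r, ~ reduction_step ok D q r.

(* The general CheckStore; the value of x is the input of Reductions. *)
Definition general_blocks (x : mpair) q : bool :=
  ~~ [exists i, q == initial_pair i] && equivp q (value x).

Definition pdeg p : nat := oapp (@mdeg n) 0%N (lm p.2).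

Definition F5_lt p1 p2 : bool :=
  if (sig p1, sig p2) is (Some (_, i), Some (_, j))
  then (j < i)%N || ((i == j) && (pdeg p1 < pdeg p2)%N) else false.

Definition F5_syzygy_criterion (D : {fset pair}) x : bool :=
  [exists q : D,
    if (sig x.2, sig (val q)) is (Some (_, i), Some (_, j))
    then (i < j)%N && osdvd (osmul (lm (val q).2) (Some (0%MM, i))) (msig x)
    else false].

Definition rewritten_criterion (rules : seq pair) x : bool :=
  if [seq r <- rules | osdvd (sig r) (msig x)] is r :: _ then x.2 != r
  else false.

Definition F5_criterions (s : state (seq pair)) x : bool :=
  F5_syzygy_criterion (DONE s) x || rewritten_criterion (memo s) x.

Definition F5_replace (s : state (seq pair)) x : state (seq pair) :=
  if F5_criterions s x then s
  else State (DONE s) ((0%MM, value x) |` (TODO s `\ x)) (value x :: memo s).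

(* l lists the multiplied pairs of smallest F5 order in TODO, in an arbitrary
   order; each is tested against the Rules left by the previous ones. *)
Definition F5_prepare (s s1 : state (seq pair)) : Prop :=
  exists2 l : seq mpair,
    perm_eq l [seq x <- TODO s |
                all (fun y => ~~ F5_lt (value y) (value x)) (TODO s)]
    & s1 = foldl F5_replace s l.

Definition TRB_F5 : algorithm := {|
  memory := seq pair;
  memory0 := [::];
  prepare := F5_prepare;
  criterions := F5_criterions;
  reductions s := exhaustive_reduction (fun x => ~~ F5_criterions s x) (DONE s);
  blocks _ x q := general_blocks x q;
  update s x q := [seq if r == value x then q else r | r <- memo s] |}.

Definition esyzygy_criterion (D : {fset pair}) x : bool :=
  [exists q : D, exists i : 'I_d,
    pair_lt (initial_pair i) (val q) &&
    osdvd (osmul (lm (val q).2) (Some (0%MM, i))) (msig x)].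

Definition erewritten_criterion (D : {fset pair}) x : bool :=
  [exists q : D,
    osdvd (sig (val q)) (msig x) && olt lts (sig x.2) (sig (val q))].

Definition EF5_criterions (s : state unit) x : bool :=
  esyzygy_criterion (DONE s) x || erewritten_criterion (DONE s) x.

Definition TRB_EF5 : algorithm := {|
  memory := unit;
  memory0 := tt;
  prepare s s1 := s1 = s;
  criterions := EF5_criterions;
  reductions s :=
    exhaustive_reduction (fun x => ~~ EF5_criterions s x) (DONE s);
  blocks _ x q := general_blocks x q;
  update _ _ _ := tt |}.

(* Syzygies is never built: t is tested against its members.  In v2 p1 and
   v1 p2 the factors are whole polynomials, since the orders on P and P^d need
   not be compatible with each other. *)
Definition gsyzygy_divides (D : {fset pair}) (t : option (smon n d)) : bool :=
  [exists q : D, ~~ nonsyzygy (val q) && osdvd (sig (val q)) t] ||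
  [exists q1 : D, exists q2 : D,
    let s1 := sig (pscale (val q2).2 (val q1)) in
    let s2 := sig (pscale (val q1).2 (val q2)) in
    (s1 != s2) && osdvd (omax lts s1 s2) t].

(* The memory lists the multiplied pairs that have passed GVWCriterions. *)
Definition GVW_criterions (s : state (seq mpair)) x : bool :=
  gsyzygy_divides (DONE s) (msig x) || has (fun y => msig y == msig x) (memo s).

Definition GVW_blocks (D : {fset pair}) q : Prop :=
  exists x : mpair, x.2 \in D /\ equivp q (value x).

Definition TRB_GVW : algorithm := {|
  memory := seq mpair;
  memory0 := [::];
  prepare s s1 := s1 = s;
  criterions := GVW_criterions;
  reductions s := exhaustive_reduction predT (DONE s);
  blocks s _ q := GVW_blocks (DONE s) q;
  update s x _ := x :: memo s |}.

End Pairs.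

Section SignatureOrders.
Context {K : fieldType} {n d : nat}.
Variables (ltm : rel 'X_{1..n}) (f : 'I_d -> {mpoly K[n]}).

Definition F5_order : rel (smon n d) := fun s t =>
  (t.2 < s.2)%N || ((s.2 == t.2) && ltm s.1 t.1).

(* x^a E_i is compared through x^a f_j, not x^a f_i: the order on x^a / lm(f_i). *)
Definition EF5_order_a : rel (smon n d) := fun s t =>
  let ms := lm ltm ('X_[s.1] * f t.2) in
  let mt := lm ltm ('X_[t.1] * f s.2) in
  olt ltm ms mt ||
  ((ms == mt) && olt ltm (lm ltm (f t.2)) (lm ltm (f s.2))).

(* msize is the degree plus one, and 0 at the polynomial 0. *)
Definition EF5_order_b : rel (smon n d) := fun s t =>
  let ds := msize ('X_[s.1] * f s.2) in
  let dt := msize ('X_[t.1] * f t.2) in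
  [|| (ds < dt)%N,
      (ds == dt) && ltm s.1 t.1
    | [&& ds == dt, s.1 == t.1 & (s.2 < t.2)%N]].

Definition homogeneous_input : Prop := forall i, f i \is ishomog mdeg.

End SignatureOrders.

(* Main.v *)
(* Every pair can be compared with the top irreducible pairs.  A non-syzygy pair
   is top reducible iff another pair with the same leading monomial has a
   smaller signature, and two top irreducible pairs with the same signature
   have the same leading monomial.  Since an admissible order on the monomials
   of P^d is well founded (Dickson), one can argue by induction on signatures.

   Let all multiplied pairs in TODO have signatures above t, let t be no syzygy
   signature, and let g be the element of DONE that the criterion of the
   algorithm prefers among those whose signature divides t: the largest
   signature for TRB-EF5, the smallest ratio lm/sig for TRB-GVW, the earliest
   place in Rules for TRB-F5.  Then the multiple of g with signature t is top
   irreducible.  Otherwise it is top reduced by a pair of smaller signature, by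
   induction by a multiple of some h in DONE; the J-pair of g and h is a multiple
   of g whose signature divides t, it has been processed, and this has put into
   DONE (or has revealed there) an element preferred to g.

   Hence a value that the reductions by DONE, restricted by the criteria, leave
   unchanged is top irreducible, and every TRB pair with signature t, having no
   proper divisor in its similar set, is equivalent to an element of DONE.
   CheckStore of TRB-F5 and TRB-EF5 never blocks anything, since the value of a
   J-pair is top reducible. *)

From Stdlib Require Import Relation_Operators Classical ClassicalEpsilon.
From mathcomp Require Import all_boot all_order all_algebra.
From mathcomp Require Import finmap mpoly zify.
Require Import Defs.

Set Implicit Arguments.
Unset Strict Implicit.
Unset Printing Implicit Defensive.

Import GRing.Theory.
Local Open Scope ring_scope.
Local Open Scope fset_scope.

(** * Well-foundedness of admissible orders *)

(** Each tail of [g] attains a minimum. [phi] repeatedly takes a position of the minimum of the tail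
    that lies beyond the previous choice, and the minima of shrinking tails cannot decrease. *)
Lemma nondecreasing_subsequence (g : nat -> nat) :
  exists phi : nat -> nat, {homo phi : i j / (i < j)%N} /\
    {homo g \o phi : i j / (i <= j)%N}.
Proof.
have tail_min N : {k : nat | (N <= k)%N /\ forall j, (N <= j)%N -> (g k <= g j)%N}.
  apply: constructive_indefinite_description.
  have [v Ev] : {v | v = g N} by exists (g N).
  have [k Ek] : {k | k = N} by exists N.
  have le_Nk : (N <= k)%N by rewrite Ek.
  have {Ek Ev} gk : g k = v by rewrite Ek Ev.
  (* Descent on the value [v] at the current candidate [k]: a smaller value in the tail gives a new
     candidate. *)
  elim/ltn_ind: v k le_Nk gk => v IH k le_Nk gk.
  have [[j [le_Nj lt_j]]|no_less] :=
      classic (exists j, (N <= j)%N /\ (g j < v)%N); first exact: IH lt_j _ le_Nj _.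
  exists k; split=> // j le_Nj; rewrite gk leqNgt; apply/negP => lt_j.
  by apply: no_less; exists j.
pose phi := fix phi k :=
  if k is k'.+1 then sval (tail_min (phi k').+1) else sval (tail_min 0%N).
have phi_mono : {homo phi : i j / (i < j)%N}.
  apply: homo_ltn => [j i k|k]; first exact: ltn_trans.
  by case: (svalP (tail_min (phi k).+1)).
exists phi; split=> //.
apply: homo_leq => // [j i k|k /=]; first exact: leq_trans.
case: k => [|k] /=; [case: (svalP (tail_min 0%N)) => _ | ].
  exact.
case: (svalP (tail_min (phi k).+1)) => _; apply.
by apply: leq_trans (proj1 (svalP (tail_min _))); exact/leqW/(phi_mono k k.+1).
Qed.

(** Refine once per sequence: what is nondecreasing along [phi] stays so along any further
    subsequence. *)
Lemma simultaneous_nondecreasing_subsequence (g : nat -> nat -> nat) N :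
  exists phi : nat -> nat, {homo phi : i j / (i < j)%N} /\
    forall k, (k < N)%N -> {homo g k \o phi : i j / (i <= j)%N}.
Proof.
elim: N => [|N [phi [phi_mono phi_g]]]; first by exists id; split.
have [psi [psi_mono psi_g]] := nondecreasing_subsequence (g N \o phi).
exists (phi \o psi); split=> [i j lt_ij|k]; first by apply: phi_mono; apply: psi_mono.
rewrite ltnS leq_eqVlt => /predU1P[-> //|lt_kN] i j le_ij /=.
exact/(phi_g k lt_kN)/(ltnW_homo psi_mono).
Qed.

(** Classically, an inaccessible element has an inaccessible predecessor; choice lets this be
    iterated. *)
Lemma not_Acc_descending (T : Type) (r : T -> T -> Prop) (x : T) :
  ~ Acc r x -> exists s : nat -> T, forall k, r (s k.+1) (s k).
Proof.
move=> nacc_x.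
have next (y : {y | ~ Acc r y}) : {z : {z | ~ Acc r z} | r (sval z) (sval y)}.
  apply: constructive_indefinite_description; apply: NNPP => no_next.
  apply: (svalP y); split=> z r_zy; apply: NNPP => nacc_z.
  by apply: no_next; exists (exist _ z nacc_z).
exists (fun k => sval (iter k (fun y => sval (next y)) (exist _ x nacc_x))) => k.
exact: (svalP (next _)).
Qed.

Section Wf.
Context {n d : nat}.

(** Dickson's lemma for a free module: a common nondecreasing subsequence of all coordinates already
    yields a divisibility between its first two terms. *)
Lemma dickson (s : nat -> smon n d) :
  exists i j, (i < j)%N /\ sdvd (s i) (s j).
Proof.
(* Besides the [n] exponents, both the index and its complement to [d] are tracked; as neither
   decreases, the index is constant. *)
pose g k i := if k == n then val (s i).2 else
  if k == n.+1 then (d - (s i).2)%N else nth 0%N (s i).1 k.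
have [phi [phi_mono phi_g]] := simultaneous_nondecreasing_subsequence g n.+2.
exists (phi 0%N), (phi 1%N); split; first exact: phi_mono.
have le_g k : (k < n.+2)%N -> (g k (phi 0%N) <= g k (phi 1%N))%N.
  by move=> lt_k; exact: phi_g.
apply/andP; split.
  rewrite -val_eqE eqn_leq /=.
  have := le_g n (ltnW (ltnSn _)); rewrite /g eqxx => -> /=.
  have := le_g n.+1 (ltnSn _); rewrite /g eqxx gtn_eqF ?ltnSn //.
  by rewrite leq_sub2lE // ltnW.
apply/mnm_lepP => i; have := le_g i (leqW (leqW (ltn_ord i))).
by rewrite /g (ltn_eqF (leqW (ltn_ord i))) (ltn_eqF (ltn_ord i)) !(mnm_nth 0%N).
Qed.

(** In an infinite descending chain some later term would be a multiple of an earlier one, yet a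
    multiple is never smaller. *)
Lemma admissible_smon_wf (lts : rel (smon n d)) :
  admissible_smon lts -> well_founded (fun s t => lts s t).
Proof.
case=> irr trans tot mono lt_mul s0; apply: NNPP => nacc.
have [s desc] := not_Acc_descending nacc.
have anti i j : (i < j)%N -> lts (s j) (s i).
  elim: j => // j IH; rewrite ltnS leq_eqVlt => /predU1P[-> //|/IH].
  exact/trans.
have [i [j [lt_ij /andP[/eqP eq_ij2 le_ij1]]]] := dickson s.
have := anti _ _ lt_ij.
have -> : s j = smul ((s j).1 - (s i).1)%MM (s i).
  by rewrite /smul submK // eq_ij2; case: (s j).
have [-> | nz] := eqVneq ((s j).1 - (s i).1)%MM 0%MM.
  by rewrite /smul add0m; case: (s i) => a b; rewrite irr.
by move=> /(trans _ _ _ (lt_mul _ (s i) nz)); rewrite irr.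
Qed.

End Wf.

(** * Leading elements *)

Section StrictTotalOrder.
Variables (T : eqType) (r : rel T).
Hypotheses (r_irr : irreflexive r) (r_trans : transitive r).
Hypothesis r_tot : forall x y, x != y -> r x y || r y x.
Implicit Types (P Q S : pred T) (x y z : option T).

Lemma olt_irr : irreflexive (olt r).
Proof. by case. Qed.

Lemma olt_trans : transitive (olt r).
Proof. by move=> [y|] [x|] [z|] //=; apply: r_trans. Qed.

Lemma olt_total x y : x != y -> olt r x y || olt r y x.
Proof. by case: x y => [x|] [y|] //= ne_xy; apply: r_tot. Qed.

Lemma olt_asym x y : olt r x y -> ~~ olt r y x.
Proof. by move=> lt_xy; apply/negP => /(olt_trans lt_xy); rewrite olt_irr. Qed.

Lemma ole_lt_trans x y z : ~~ olt r y x -> olt r y z -> olt r x z.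
Proof. by have [-> // | /olt_total/orP[|-> //]] := eqVneq x y; move=> /olt_trans + _; apply. Qed.

Lemma olt_le_trans x y z : olt r x y -> ~~ olt r z y -> olt r x z.
Proof. by have [-> // | /olt_total/orP[|-> //]] := eqVneq y z; move=> lt_yz /olt_trans + _; apply. Qed.

(** Leading monomials are characterised through the support rather than as iterated maxima, so that
    they can be computed by uniqueness. [None] belongs to the empty support. *)
Definition is_lead P x : Prop :=
  if x is Some s then P s /\ forall t, P t -> ~~ r s t else forall t, ~~ P t.

Lemma lead_unique P x y : is_lead P x -> is_lead P y -> x = y.
Proof.
case: x y => [s|] [t|] //=; last by move=> + [Pt _] => /(_ t); rewrite Pt.
  move=> [Ps max_s] [Pt max_t]; apply/eqP; apply: contraT => /olt_total /=.
  by rewrite (negPf (max_s _ Pt)) (negPf (max_t _ Ps)).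
by move=> [Ps _] /(_ s); rewrite Ps.
Qed.

Lemma eq_lead P Q x : P =1 Q -> is_lead P x -> is_lead Q x.
Proof.
move=> eq_PQ; case: x => [s [Ps max_s]|no] /=.
  by split=> [|t]; rewrite -eq_PQ //; apply: max_s.
by move=> t; rewrite -eq_PQ.
Qed.

Lemma lead_ge P x t : is_lead P x -> P t -> ~~ olt r x (Some t).
Proof. by case: x => [s [_]|no Pt] /=; [apply | move: (no t); rewrite Pt]. Qed.

Lemma lead_lt P x s : is_lead P x -> (forall t, P t -> r t s) ->
  olt r x (Some s).
Proof. by case: x => [t [Pt _]|] //=; apply. Qed.

Lemma lead_omax P Q x y : is_lead P x -> is_lead Q y ->
  is_lead (fun t => P t || Q t) (omax r x y).
Proof.
rewrite /omax; case: ifPn => lt_xy leadP leadQ.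
  case: y lt_xy leadQ => [s|]; last by rewrite /olt; case: x {leadP}.
  move=> lt_xs [Qs max_s] /=; split=> [|t]; first by rewrite Qs orbT.
  case/orP=> [/(lead_ge leadP)|/max_s //].
  by move=> le_tx; apply: (@olt_asym (Some t) (Some s)); apply: ole_lt_trans lt_xs.
case: x lt_xy leadP => [s|] nlt.
  move=> [Ps max_s]; split=> [|t]; first by rewrite Ps.
  case/orP=> [/max_s //|/(lead_ge leadQ) le_ty].
  apply/negP => lt_st; case/negP: nlt.
  by apply: (@olt_le_trans _ (Some t)).
case: y nlt leadQ => // _ noQ noP /= t; rewrite negb_or; exact/andP.
Qed.

Lemma lead_big (I : eqType) (s : seq I) (P : I -> pred T) (F : I -> option T) :
  (forall i, is_lead (P i) (F i)) ->
  is_lead (fun t => has (fun i => P i t) s) (\big[omax r/None]_(i <- s) F i).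
Proof.
move=> leadF; elim: s => [|i s IH]; first by rewrite big_nil.
by rewrite big_cons; apply: lead_omax.
Qed.

(** [P] and [Q] stand for the supports of two terms and [S] for the support of their difference: a
    dominating leading element survives. The next lemma treats equal leading elements that
    cancel. *)
Lemma lead_sum_lt P Q S x s : is_lead P (Some s) -> is_lead Q x ->
  olt r x (Some s) -> (forall t, S t -> P t || Q t) -> S s -> is_lead S (Some s).
Proof.
move=> [Ps max_s] leadQ lt_xs subS Ss; split=> // t /subS/orP[/max_s //|].
move/(lead_ge leadQ) => le_tx.
by apply: (@olt_asym (Some t) (Some s)); apply: ole_lt_trans lt_xs.
Qed.

Lemma lead_sum_cancel P Q S y s : is_lead P (Some s) -> is_lead Q (Some s) ->
  is_lead S y -> (forall t, S t -> P t || Q t) -> ~~ S s -> olt r y (Some s).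
Proof.
move=> leadP leadQ leadS subS nSs; apply: (lead_lt leadS) => t St /=.
have ne_ts : t != s by apply: contraNneq nSs => <-.
have /orP[//|lt_st] := r_tot ne_ts.
by case/orP: (subS t St) => [/(proj2 leadP)|/(proj2 leadQ)]; rewrite lt_st.
Qed.

Lemma lead_homo P Q x (h : T -> T) : {homo h : s t / r s t} ->
  (forall t, Q t -> exists2 s, P s & t = h s) -> (forall s, P s -> Q (h s)) ->
  is_lead P x -> is_lead Q (omap h x).
Proof.
move=> homo_h QP PQ; case: x => [s [Ps max_s]|noP] /=.
  split=> [|_ /QP[t Pt ->]]; first exact: PQ.
  have [->|/r_tot/orP[/homo_h lt_ts|]] := eqVneq t s; first by rewrite r_irr.
    exact: (@olt_asym (Some (h t)) (Some (h s))).
  by rewrite (negPf (max_s _ Pt)).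
by move=> t; apply/negP => /QP[s Ps _]; move: (noP s); rewrite Ps.
Qed.

End StrictTotalOrder.

(** * Pairs, signatures and top irreducibility *)

Section SignatureTheory.
Context {K : fieldType} {n d : nat}.
Variables (ltm : rel 'X_{1..n}) (lts : rel (smon n d)) (f : 'I_d -> {mpoly K[n]}).
Hypotheses (adm_m : admissible_mon ltm) (adm_s : admissible_smon lts).
Notation P := {mpoly K[n]}.
Notation pair := (pair_t K n d).
Notation LM := (lm ltm).
Notation SIG := (sig lts).
Implicit Types (m : 'X_{1..n}) (s t : smon n d) (v : P) (p q g h : pair).

Lemma ltm_irr : irreflexive ltm. Proof. by case: adm_m. Qed.
Lemma ltm_trans : transitive ltm. Proof. by case: adm_m. Qed.
Lemma ltm_tot m1 m2 : m1 != m2 -> ltm m1 m2 || ltm m2 m1.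
Proof. by case: adm_m => _ _ + _ _; apply. Qed.
Lemma lts_irr : irreflexive lts. Proof. by case: adm_s. Qed.
Lemma lts_trans : transitive lts. Proof. by case: adm_s. Qed.
Lemma lts_tot s t : s != t -> lts s t || lts t s.
Proof. by case: adm_s => _ _ + _ _; apply. Qed.

Lemma ltm_add2l m m1 m2 : ltm (m + m1)%MM (m + m2)%MM = ltm m1 m2.
Proof.
case: adm_m => irr trans tot mono _; apply/idP/idP => [lt12|]; last exact: mono.
have [eq12|/tot/orP[//|/(mono m)/(trans _ _ _ lt12)]] := eqVneq m1 m2.
  by rewrite eq12 irr in lt12.
by rewrite irr.
Qed.

Lemma lts_smul m s t : lts (smul m s) (smul m t) = lts s t.
Proof.
case: adm_s => irr trans tot mono _; apply/idP/idP => [lt12|]; last exact: mono.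
have [eq12|/tot/orP[//|/(mono m)/(trans _ _ _ lt12)]] := eqVneq s t.
  by rewrite eq12 irr in lt12.
by rewrite irr.
Qed.

Lemma smulA m1 m2 s : smul m1 (smul m2 s) = smul (m1 + m2)%MM s.
Proof. by rewrite /smul /= addmA. Qed.

Lemma smul0m s : smul 0%MM s = s.
Proof. by case: s => a i; rewrite /smul /= add0m. Qed.

Lemma sdvdP s t : reflect (t = smul (t.1 - s.1)%MM s) (sdvd s t).
Proof.
apply: (iffP andP) => [[/eqP eq2 le1]|->] /=; last by rewrite eqxx lem_addl.
by rewrite /smul submK // eq2; case: t {eq2 le1}.
Qed.

Lemma sdvd_smul m s : sdvd s (smul m s).
Proof. by rewrite /sdvd /= eqxx lem_addl. Qed.

Lemma sdvd_refl s : sdvd s s.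
Proof. by rewrite -{2}(smul0m s) sdvd_smul. Qed.

Lemma sdvd_trans s2 s1 s3 : sdvd s1 s2 -> sdvd s2 s3 -> sdvd s1 s3.
Proof. by move=> /sdvdP-> /sdvdP->; rewrite smulA sdvd_smul. Qed.

Lemma sdvd_anti s t : sdvd s t -> sdvd t s -> s = t.
Proof.
move=> /andP[/eqP e2 le1] /andP[_ le1'].
case: s t e2 le1 le1' => [a i] [b j] /= -> le1 le1'; congr (_, _).
by apply/mnmP => k; apply/eqP; rewrite eqn_leq (mnm_lepP le1) (mnm_lepP le1').
Qed.

Lemma sdvd_initial t i : sdvd t (0%MM, i) -> t = (0%MM, i).
Proof.
move=> dvd_t; apply: (sdvd_anti dvd_t); case/andP: dvd_t => /eqP e2 _.
by rewrite /sdvd e2 eqxx; apply/mnm_lepP => k; rewrite mnm0E.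
Qed.

Lemma lts_smul_ge m s : ~~ lts (smul m s) s.
Proof.
have [->|nz] := eqVneq m 0%MM; first by rewrite smul0m lts_irr.
case: adm_s => irr trans _ _ /(_ m s nz) lt_s.
by apply/negP => /(trans _ _ _ lt_s); rewrite irr.
Qed.

Lemma sdvd_ge s t : sdvd s t -> ~~ lts t s.
Proof. by move=> /sdvdP->; apply: lts_smul_ge. Qed.

(** * Leading monomials of polynomials and vectors under scaling and subtraction *)

Definition msupport v : pred 'X_{1..n} := fun m => v@_m != 0.
Definition smsupport (u : 'rV[P]_d) : pred (smon n d) :=
  fun s => (u 0 s.2)@_s.1 != 0.

Lemma lmP v : is_lead ltm (msupport v) (LM v).
Proof.
have lead1 m : is_lead ltm (pred1 m) (Some m).
  by split=> [|t /eqP ->] /=; rewrite ?eqxx ?ltm_irr.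
have := lead_big ltm_irr ltm_trans ltm_tot (msupp v) lead1; apply: eq_lead => m.
by rewrite /msupport -mcoeff_msupp; apply/hasP/idP => [[x ? /eqP->]|]; last exists m => /=.
Qed.

Lemma lmvP (u : 'rV[P]_d) : is_lead lts (smsupport u) (lmv lts u).
Proof.
have lead1 (s : smon n d) : is_lead lts (pred1 s) (Some s).
  by split=> [|t /eqP ->] /=; rewrite ?eqxx ?lts_irr.
have lead2 (i : 'I_d) := lead_big lts_irr lts_trans lts_tot (msupp (u 0 i))
  (fun m : 'X_{1..n} => lead1 (m, i)).
have := lead_big lts_irr lts_trans lts_tot (index_enum 'I_d) lead2.
apply: eq_lead => -[m i]; rewrite /smsupport -mcoeff_msupp /=.
apply/hasP/idP => [[j _ /hasP[m' sm /eqP[-> ->//]]]|sm].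
by exists i; rewrite ?mem_index_enum //; apply/hasP; exists m => /=.
Qed.

Lemma lm_eq0 v : (LM v == None) = (v == 0).
Proof.
have := lmP v; case: (LM v) => [m [sm _]|no] /=.
  by apply/esym; apply: contraNF sm => /eqP->; rewrite mcoeff0.
apply/esym/eqP/mpolyP => m; rewrite mcoeff0; apply/eqP; rewrite -[_ == _]negbK; exact: no.
Qed.

Lemma lm0 : LM (0 : P) = None.
Proof. by apply/eqP; rewrite lm_eq0. Qed.

Lemma lmv_None (u : 'rV[P]_d) : lmv lts u = None -> u = 0.
Proof.
have := lmvP u => /[swap] -> /= no; apply/rowP => i; apply/mpolyP => m.
by rewrite mxE mcoeff0; apply/eqP; rewrite -[_ == _]negbK; apply: (no (m, i)).
Qed.

Lemma mcoeff_mulX m m' v : ('X_[m] * v)@_(m + m') = v@_m'.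
Proof. by rewrite mulrC mcoeffMX. Qed.

Lemma msupport_mulX m v m' : msupport ('X_[m] * v) m' ->
  exists2 m0, msupport v m0 & m' = (m + m0)%MM.
Proof.
rewrite /msupport -mcoeff_msupp mulrC (perm_mem (msuppMX v m)).
by case/mapP => m0; rewrite mcoeff_msupp => sm0 ->; exists m0.
Qed.

Lemma lm_mulX m v : LM ('X_[m] * v) = omap (mnm_add m) (LM v).
Proof.
apply: (lead_unique ltm_tot (lmP _)).
apply: (lead_homo ltm_irr ltm_trans ltm_tot _ _ _ (lmP v)).
- by move=> m1 m2; rewrite ltm_add2l.
- by move=> m' /msupport_mulX[m0 sm0 ->]; exists m0.
by move=> m0; rewrite /msupport mcoeff_mulX.
Qed.

Lemma lmv_scaleX m (u : 'rV[P]_d) : lmv lts ('X_[m] *: u) = omap (smul m) (lmv lts u).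
Proof.
apply: (lead_unique lts_tot (lmvP _)).
apply: (lead_homo lts_irr lts_trans lts_tot _ _ _ (lmvP u)).
- by move=> m1 m2; rewrite lts_smul.
- move=> [m' i]; rewrite /smsupport /= mxE => /msupport_mulX[m0 sm0 ->].
  by exists (m0, i).
by move=> [m0 i]; rewrite /smsupport /= mxE mcoeff_mulX.
Qed.

Lemma lm_scaleC (c : K) v : c != 0 -> LM (c%:MP * v) = LM v.
Proof.
move=> nz_c; apply: (lead_unique ltm_tot (lmP _)); apply: eq_lead (lmP v) => m.
by rewrite /msupport mcoeffCM mulf_eq0 (negPf nz_c).
Qed.

Lemma lmv_scaleC (c : K) (u : 'rV[P]_d) : c != 0 -> lmv lts (c%:MP *: u) = lmv lts u.
Proof.
move=> nz_c; apply: (lead_unique lts_tot (lmvP _)); apply: eq_lead (lmvP u) => s.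
by rewrite /smsupport mxE mcoeffCM mulf_eq0 (negPf nz_c).
Qed.

Lemma msupport_sub v1 v2 m : msupport (v1 - v2) m -> msupport v1 m || msupport v2 m.
Proof.
rewrite /msupport mcoeffB; apply: contraNT; rewrite negb_or !negbK => /andP[/eqP-> /eqP->].
by rewrite subr0.
Qed.

Lemma smsupport_sub (u1 u2 : 'rV[P]_d) s :
  smsupport (u1 - u2) s -> smsupport u1 s || smsupport u2 s.
Proof. by rewrite /smsupport !mxE; apply: msupport_sub. Qed.

Lemma lm_sub_lt v1 v2 m : LM v1 = Some m -> olt ltm (LM v2) (Some m) ->
  LM (v1 - v2) = Some m.
Proof.
move=> lm1 lt2; apply: (lead_unique ltm_tot (lmP _)).
have lead1 := lmP v1; rewrite lm1 in lead1.
apply: (lead_sum_lt ltm_irr ltm_trans ltm_tot lead1 (lmP v2) lt2 (@msupport_sub _ _)).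
have v2m : v2@_m = 0.
  apply/eqP; rewrite -[_ == _]negbK; apply/negP => /(lead_ge (lmP v2)).
  by rewrite lt2.
by case: lead1 => + _; rewrite /msupport mcoeffB v2m subr0.
Qed.

Lemma lmv_sub_lt (u1 u2 : 'rV[P]_d) s :
  lmv lts u1 = Some s -> olt lts (lmv lts u2) (Some s) -> lmv lts (u1 - u2) = Some s.
Proof.
move=> lm1 lt2; apply: (lead_unique lts_tot (lmvP _)).
have lead1 := lmvP u1; rewrite lm1 in lead1.
apply: (lead_sum_lt lts_irr lts_trans lts_tot lead1 (lmvP u2) lt2 (@smsupport_sub _ _)).
have u2s : (u2 0 s.2)@_s.1 = 0.
  apply/eqP; rewrite -[_ == _]negbK; apply/negP => nz.
  by have := @lead_ge _ _ _ _ s (lmvP u2) nz; rewrite lt2.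
by case: lead1 => + _; rewrite /smsupport !mxE mcoeffB u2s subr0.
Qed.

Lemma lm_sub_cancel v1 v2 m : LM v1 = Some m -> LM v2 = Some m -> v1@_m = v2@_m ->
  olt ltm (LM (v1 - v2)) (Some m).
Proof.
move=> lm1 lm2 eq12; have lead1 := lmP v1; have lead2 := lmP v2.
rewrite lm1 in lead1; rewrite lm2 in lead2.
apply: (lead_sum_cancel ltm_tot lead1 lead2 (lmP _) (@msupport_sub _ _)).
by rewrite /msupport mcoeffB eq12 subrr eqxx.
Qed.

Lemma lmv_sub_cancel (u1 u2 : 'rV[P]_d) s :
  lmv lts u1 = Some s -> lmv lts u2 = Some s -> (u1 0 s.2)@_s.1 = (u2 0 s.2)@_s.1 ->
  olt lts (lmv lts (u1 - u2)) (Some s).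
Proof.
move=> lm1 lm2 eq12; have lead1 := lmvP u1; have lead2 := lmvP u2.
rewrite lm1 in lead1; rewrite lm2 in lead2.
apply: (lead_sum_cancel lts_tot lead1 lead2 (lmvP _) (@smsupport_sub _ _)).
by rewrite /smsupport !mxE mcoeffB eq12 subrr eqxx.
Qed.

Lemma lm_coeff v m : LM v = Some m -> v@_m != 0.
Proof. by have := lmP v => /[swap] -> []. Qed.

Lemma lmv_coeff (u : 'rV[P]_d) s : lmv lts u = Some s -> (u 0 s.2)@_s.1 != 0.
Proof. by have := lmvP u => /[swap] -> []. Qed.

(** * The module of pairs and top reduction *)

Lemma is_pairB p q : is_pair f p -> is_pair f q -> is_pair f (p - q).
Proof.
rewrite /is_pair /= => <- <-; rewrite -sumrB; apply: eq_bigr => i _.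
by rewrite !mxE mulrBl.
Qed.

Lemma is_pair_scale (c : P) p : is_pair f p -> is_pair f (pscale c p).
Proof.
rewrite /is_pair /= => <-; rewrite big_distrr; apply: eq_bigr => i _.
by rewrite mxE -mulrA.
Qed.

Lemma is_pair_initial i : is_pair f (initial_pair f i).
Proof.
rewrite /is_pair /= (bigD1 i) //= big1 => [|j ne_ji].
  by rewrite mxE !eqxx mul1r addr0.
by rewrite mxE (negPf ne_ji) andbF mul0r.
Qed.

Lemma sig_initial i : SIG (initial_pair f i) = Some (0%MM, i).
Proof.
apply: (lead_unique lts_tot (lmvP _)).
have supp (s : smon n d) : smsupport (delta_mx 0 i) s = (s == (0%MM, i)).
  case: s => m j; rewrite /smsupport /= mxE eqxx xpair_eqE.
  have [_|_] := eqVneq j i; first by rewrite mcoeff1 andbT; case: (m == 0%MM); rewrite /= ?oner_eq0 ?eqxx.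
  by rewrite mcoeff0 eqxx andbF.
by split=> [|t]; rewrite supp ?eqxx // => /eqP->; rewrite lts_irr.
Qed.

Lemma pair_sig_None p : is_pair f p -> SIG p = None -> p.2 = 0.
Proof.
rewrite /is_pair => <- /lmv_None ->; apply: big1 => i _.
by rewrite mxE mul0r.
Qed.

Lemma sig_scaleX m p : SIG (pscale 'X_[m] p) = omap (smul m) (SIG p).
Proof. exact: lmv_scaleX. Qed.

Lemma pscale_CX (c : K) m p :
  pscale (c *: 'X_[m]) p = pscale c%:MP (pscale 'X_[m] p).
Proof. by rewrite /pscale /= scalerA mulrA mul_mpolyC. Qed.

Lemma sig_scaleCX (c : K) m p : c != 0 ->
  SIG (pscale (c *: 'X_[m]) p) = omap (smul m) (SIG p).
Proof. by move=> nz_c; rewrite pscale_CX /sig lmv_scaleC // lmv_scaleX. Qed.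

Lemma lm_scaleCX (c : K) m p : c != 0 ->
  LM (pscale (c *: 'X_[m]) p).2 = omap (mnm_add m) (LM p.2).
Proof. by move=> nz_c; rewrite pscale_CX /= lm_scaleC // lm_mulX. Qed.

(** Dividing the defining comparison by lm(q) turns it into a condition on signatures: the multiple
    of [q] with the leading monomial of [p] has a smaller signature than [p]. The signature of [q]
    exists because a zero vector would force a zero polynomial part. *)
Lemma top_reducibleP p q : is_pair f q ->
  reflect (exists a b t, [/\ LM p.2 = Some a, LM q.2 = Some b, SIG q = Some t,
             (b <= a)%MM & olt lts (Some (smul (a - b)%MM t)) (SIG p)])
          (top_reducible ltm lts p q).
Proof.
move=> pair_q; rewrite /top_reducible /nonsyzygy /pair_lt.
case Ea: (LM p.2) => [a|]; last by constructor=> -[? [? [? []]]].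
case Eb: (LM q.2) => [b|]; last by constructor=> -[? [? [? []]]].
case Et: (SIG q) => [t|]; last first.
  by move/(pair_sig_None pair_q): Et Eb => ->; rewrite lm0.
case Es: (SIG p) => [s|] /=; last by constructor=> -[? [? [? []]]].
apply: (iffP andP) => [[lt_ab le_ba]|[_ [_ [_ [[<-] [<-] [<-] le_ba lt_ts]]]]].
  exists a, b, t; split=> //; rewrite -(lts_smul b) smulA addmC submK //.
by split=> //; rewrite -[a in smul a t](submK le_ba) addmC -smulA lts_smul.
Qed.

(** The subtracted multiple has a smaller signature, so the signature is kept; the quotient of
    leading coefficients cancels the leading terms of the polynomial parts. *)
Lemma top_reductionP p q : is_pair f q -> top_reducible ltm lts p q ->
  SIG (top_reduction ltm p q) = SIG p /\
  olt ltm (LM (top_reduction ltm p q).2) (LM p.2).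
Proof.
move=> pair_q /(top_reducibleP _ pair_q)[a [b [t [Ea Eb Et le_ba lt_ts]]]].
rewrite /top_reduction /lt_quot Ea Eb; set c := _ / _.
have nz_c : c != 0 by rewrite mulf_neq0 ?invr_eq0 ?(lm_coeff Ea) ?(lm_coeff Eb).
case Es: (SIG p) lt_ts => [s|//] lt_ts; split.
  by apply: lmv_sub_lt Es _; rewrite -[lmv _ _]/(SIG (pscale _ q)) sig_scaleCX // Et.
apply: lm_sub_cancel Ea _ _ => /=.
  by rewrite (lm_scaleCX _ q nz_c) Eb /= submK.
have := mcoeff_mulX (a - b)%MM b q.2; rewrite submK // -scalerAl mcoeffZ => ->.
by rewrite /c divfK // (lm_coeff Eb).
Qed.

Lemma is_pair_top_reduction p q : is_pair f p -> is_pair f q ->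
  is_pair f (top_reduction ltm p q).
Proof. by move=> pair_p pair_q; apply/is_pairB/is_pair_scale. Qed.

(** * Top irreducible pairs and syzygy signatures *)

Definition syzygy_sig s : Prop :=
  exists2 p, is_pair f p & p.2 = 0 /\ SIG p = Some s.

Notation irreducible := (top_irreducible ltm lts f).

Lemma smaller_sig_reducible p q : is_pair f q -> LM p.2 != None -> LM q.2 = LM p.2 ->
  olt lts (SIG q) (SIG p) -> top_reducible ltm lts p q.
Proof.
move=> pair_q nz eq_lm lt_qp; apply/(top_reducibleP _ pair_q).
case Ea: (LM p.2) nz eq_lm => [a|//] _ Eq.
case Et: (SIG q) => [t|]; last first.
  by move/(pair_sig_None pair_q): Et Eq => ->; rewrite lm0.
exists a, a, t; split=> //; first exact: lepm_refl.
by have -> : (a - a)%MM = 0%MM by [apply/mnmP=> i; rewrite mnmBE mnm0E subnn]; rewrite smul0m -Et.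
Qed.

Lemma reducible_smaller_sig p q : is_pair f q -> top_reducible ltm lts p q ->
  exists2 m, LM (value (m, q)).2 = LM p.2 & olt lts (msig lts (m, q)) (SIG p).
Proof.
move=> pair_q /(top_reducibleP _ pair_q)[a [b [t [Ea Eb Et le_ba lt_ts]]]].
exists (a - b)%MM; first by rewrite lm_mulX Eb /= submK.
by rewrite /msig sig_scaleX Et.
Qed.

Lemma irreducible_min_sig p q : irreducible p -> is_pair f q -> LM p.2 != None ->
  LM q.2 = LM p.2 -> ~~ olt lts (SIG q) (SIG p).
Proof.
move=> irr_p pair_q nz eq_lm; apply: contra (irr_p q pair_q).
exact: smaller_sig_reducible.
Qed.

Lemma irreducible_equivp p q : SIG p = SIG q -> LM p.2 = LM q.2 ->
  irreducible p -> irreducible q.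
Proof.
move=> eq_sig eq_lm irr_p r pair_r; move: (irr_p r pair_r).
by rewrite /top_reducible /nonsyzygy /pair_lt eq_sig eq_lm.
Qed.

(** Were lm(q) smaller, subtracting a scalar multiple of [q] would lower the signature of [p] and
    keep its leading monomial; the difference would then top reduce [p]. *)
Lemma irreducible_min_lm p q s : irreducible p -> is_pair f p -> is_pair f q ->
  SIG p = Some s -> SIG q = Some s -> ~~ olt ltm (LM q.2) (LM p.2).
Proof.
move=> irr_p pair_p pair_q sig_p sig_q; apply/negP => lt_lm.
(* The quotient of the leading coefficients of the two vectors, so that their leading terms
   cancel. *)
pose c := (p.1 0 s.2)@_s.1 / (q.1 0 s.2)@_s.1.
have nz_c : c != 0.
  by rewrite mulf_neq0 ?invr_eq0 ?(lmv_coeff sig_p) ?(lmv_coeff sig_q).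
have pair_r := is_pairB pair_p (is_pair_scale c%:MP pair_q).
have sig_cq : SIG (pscale c%:MP q) = Some s by rewrite /sig lmv_scaleC.
case Ea: (LM p.2) lt_lm => [a|]; last by case: (LM q.2).
move=> lt_lm; have := irreducible_min_sig irr_p pair_r; rewrite Ea => /(_ isT).
have -> : LM (p - pscale c%:MP q).2 = Some a.
  by apply: lm_sub_lt Ea _; rewrite lm_scaleC.
move=> /(_ erefl); rewrite sig_p => /negP; apply.
apply: lmv_sub_cancel sig_p sig_cq _.
by rewrite mxE mcoeffCM /c divfK // (lmv_coeff sig_q).
Qed.

Lemma irreducible_lm_unique p q s : irreducible p -> irreducible q ->
  is_pair f p -> is_pair f q -> SIG p = Some s -> SIG q = Some s -> LM p.2 = LM q.2.
Proof.
move=> irr_p irr_q pair_p pair_q sig_p sig_q; apply/eqP; apply: contraT.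
move=> /(olt_total ltm_tot); rewrite (negPf (irreducible_min_lm irr_q pair_q pair_p sig_q sig_p)).
by rewrite (negPf (irreducible_min_lm irr_p pair_p pair_q sig_p sig_q)).
Qed.

Lemma not_irreducibleP p : ~ irreducible p ->
  exists2 q, is_pair f q & top_reducible ltm lts p q.
Proof.
move=> nirr; apply: NNPP => no; apply: nirr => q pair_q; apply/negP => red.
by apply: no; exists q.
Qed.

(** A reducible pair can be exchanged for a multiple of its reducer with the same leading monomial
    and a smaller signature; this ends because the order is well founded. *)
Lemma irreducible_below p : is_pair f p -> LM p.2 != None ->
  exists q, [/\ is_pair f q, irreducible q, LM q.2 = LM p.2
              & ~~ olt lts (SIG p) (SIG q)].
Proof.
move=> pair_p nz; case Es: (SIG p) => [s|]; last first.
  by move/(pair_sig_None pair_p): Es nz => ->; rewrite lm0.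
elim/(well_founded_ind (admissible_smon_wf adm_s)): s p pair_p nz Es => s IH p pair_p nz Es.
have [irr_p|/not_irreducibleP[r pair_r]] := classic (irreducible p).
  by exists p; split; rewrite // Es olt_irr //; apply: lts_irr.
case/(reducible_smaller_sig pair_r) => m eq_lm lt_sig.
have pair_mr : is_pair f (value (m, r)) by apply: is_pair_scale.
rewrite Es in lt_sig; move: lt_sig; rewrite /msig.
case Et: (SIG (value (m, r))) => [t|]; last first.
  by move/(pair_sig_None pair_mr): Et eq_lm nz => -> <-; rewrite lm0.
move=> lt_ts; rewrite -eq_lm in nz *.
have [q [pair_q irr_q eq_q le_q]] := IH t lt_ts _ pair_mr nz Et.
exists q; split=> //; apply: olt_asym; first exact: lts_irr. exact: lts_trans.
by apply: (ole_lt_trans lts_trans lts_tot) le_q _.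
Qed.

Lemma syzygy_sig_sdvd s t : sdvd s t -> syzygy_sig s -> syzygy_sig t.
Proof.
move=> /sdvdP-> [p pair_p [p2 sig_p]]; set m := (_ - _)%MM.
exists (pscale 'X_[m] p); first exact: is_pair_scale.
by split; [rewrite /= p2 mulr0 | rewrite sig_scaleX sig_p].
Qed.

(** A syzygy of the same signature would have the smaller leading monomial 0, against
    [irreducible_min_lm]. *)
Lemma irreducible_nonsyzygy p s : is_pair f p -> irreducible p -> LM p.2 != None ->
  SIG p = Some s -> ~ syzygy_sig s.
Proof.
move=> pair_p irr_p nz sig_p [q pair_q [q2 sig_q]].
have := irreducible_min_lm irr_p pair_p pair_q sig_p sig_q.
by rewrite q2 lm0; case: (LM p.2) nz.
Qed.

Lemma nonsyzygy_lm p s : is_pair f p -> SIG p = Some s -> ~ syzygy_sig s -> LM p.2 != None.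
Proof.
move=> pair_p sig_p nsyz; apply/negP; rewrite lm_eq0 => /eqP p2.
by apply: nsyz; exists p.
Qed.

Lemma seq_minimal (T : eqType) (r : rel T) (Q : pred T) (s : seq T) :
  irreflexive r -> transitive r -> has Q s ->
  exists x, [/\ x \in s, Q x & forall y, y \in s -> Q y -> ~~ r y x].
Proof.
move=> r_irr r_trans; elim: s => //= x s IH.
have [/IH[m [sm Qm min_m]] _|/hasPn noQ /orP[Qx|//]] := boolP (has Q s); last first.
  exists x; split; rewrite ?mem_head // => y; rewrite in_cons => /predU1P[->|sy Qy].
    by rewrite r_irr.
  by have := noQ _ sy; rewrite Qy.
have [/andP[Qx r_xm]|nx] := boolP (Q x && r x m).
  exists x; split; rewrite ?mem_head // => y; rewrite in_cons => /predU1P[->|sy Qy].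
    by rewrite r_irr.
  by apply: contra (min_m _ sy Qy) => r_yx; apply: r_trans r_xm.
exists m; split; rewrite ?in_cons ?sm ?orbT // => y; rewrite in_cons => /predU1P[->|sy Qy].
  by move: nx; rewrite negb_and => /orP[/negP|].
exact: min_m.
Qed.

Lemma jpair_pair_lt g h a b : LM g.2 = Some a -> LM h.2 = Some b ->
  pair_lt ltm lts g h -> jpair ltm lts g h = Some ((mlcm a b - a)%MM, g).
Proof.
move=> Ea Eb lt_gh; rewrite /jpair Ea Eb lt_gh ifN //.
apply: contraL lt_gh => /eqP; rewrite /pair_lt => ->.
by rewrite olt_irr //; apply: lts_irr.
Qed.

(** * Best divisors of a signature *)

Definition good_pair g : Prop := [/\ is_pair f g, irreducible g & SIG g != None].

Definition best_divisor (D : {fset pair}) (better : rel pair) t g : Prop :=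
  [/\ g \in D, osdvd (SIG g) (Some t) &
      forall g', g' \in D -> osdvd (SIG g') (Some t) -> ~~ better g' g].

(* [better] abstracts the rewriting rule of each algorithm, and [B] is the set
   of the signatures that have been dealt with. *)
Section RewriteBasis.
Variables (D : {fset pair}) (better : rel pair) (B : smon n d -> Prop).
Hypotheses (better_irr : irreflexive better) (better_trans : transitive better).
Hypothesis D_good : forall g, g \in D -> good_pair g.
Hypothesis B_down : forall s t, B t -> ~~ lts t s -> B s.
Hypothesis B_initial : forall i, B (0%MM, i) ->
  syzygy_sig (0%MM, i) \/ exists2 g, g \in D & SIG g = Some (0%MM, i).
Hypothesis B_jpair : forall g h x s, g \in D -> h \in D ->
  jpair ltm lts g h = Some x -> msig lts x = Some s -> B s ->
  syzygy_sig s \/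
  exists g', [/\ g' \in D, osdvd (SIG g') (Some s) & better g' x.2].

(** The unit vector dividing [t] has been dealt with and is no syzygy signature, so it is the
    signature of a stored pair. The finite set of candidates is thus nonempty and has an element to
    which none is preferred. *)
Lemma best_divisor_exists t : B t -> ~ syzygy_sig t ->
  exists g, best_divisor D better t g.
Proof.
move=> Bt nsyz; have dvd_t : sdvd (0%MM, t.2) t by rewrite /sdvd /= eqxx; apply/mnm_lepP => i; rewrite mnm0E.
have [|syz|[g0 Dg0 sig_g0]] := B_initial (i := t.2).
- exact: B_down Bt (sdvd_ge dvd_t).
- by case: nsyz; apply: syzygy_sig_sdvd syz.
have [|g [Dg dvd_g min_g]] := seq_minimal better_irr better_trans
    (Q := fun g => osdvd (SIG g) (Some t)) (s := D).
  by apply/hasP; exists g0; rewrite ?sig_g0.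
by exists g.
Qed.

(** Induction on [t]: a reducible multiple of [g] would come with a J-pair of component [g] whose
    treatment has produced an element preferred to [g]. *)
Lemma best_divisor_irreducible t g s : B t -> ~ syzygy_sig t ->
  best_divisor D better t g -> SIG g = Some s ->
  irreducible (value ((t.1 - s.1)%MM, g)).
Proof.
elim/(well_founded_ind (admissible_smon_wf adm_s)): t g s => t IH g s Bt nsyz.
move=> [Dg + best_g] sig_g; rewrite sig_g => dvd_st.
have [pair_g irr_g _] := D_good Dg.
set m := (_ - _)%MM; apply: NNPP => nirr.
have def_t : t = smul m s by apply/sdvdP.
have pair_mg : is_pair f (value (m, g)) by apply: is_pair_scale.
have sig_mg : SIG (value (m, g)) = Some t by rewrite sig_scaleX sig_g def_t.
have nz_mg := nonsyzygy_lm pair_mg sig_mg nsyz.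
have [q [pair_q irr_q lm_q le_q]] := irreducible_below pair_mg nz_mg.
case Et': (SIG q) => [t'|]; last first.
  by move/(pair_sig_None pair_q): Et' lm_q nz_mg => -> <-; rewrite lm0.
have lt_t't : lts t' t.
  (* With equal signatures the multiple of [g] would be equivalent to the irreducible [q]. *)
  have [/eqP eq_sig|] := eqVneq (SIG q) (SIG (value (m, g))).
    by case: nirr; apply: (irreducible_equivp _ lm_q irr_q); apply/eqP.
  by case/(olt_total lts_tot)/orP; [rewrite Et' sig_mg | rewrite (negPf le_q)].
have Bt' : B t'.
  by apply: B_down Bt _; apply: (@olt_asym _ _ lts_irr lts_trans (Some t') (Some t)).
have nz_q : LM q.2 != None by rewrite lm_q.
have nsyz' := irreducible_nonsyzygy pair_q irr_q nz_q Et'.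
(* By induction the multiple of [h] with signature [t'] is irreducible, so it has the leading
   monomial of [q], which is that of the multiple of [g]. *)
have [h best_h] := best_divisor_exists Bt' nsyz'.
have [Dh dvd_h _] := best_h; have [pair_h irr_h] := D_good Dh.
case sig_h: (SIG h) dvd_h => [s'|//] dvd_s't' _.
have irr_mh := IH _ lt_t't _ _ Bt' nsyz' best_h sig_h.
set m' := (t'.1 - s'.1)%MM in irr_mh.
have def_t' : t' = smul m' s' by apply/sdvdP.
have sig_mh : SIG (value (m', h)) = Some t' by rewrite sig_scaleX sig_h def_t'.
have lm_mh : LM (value (m', h)).2 = LM (value (m, g)).2.
  by rewrite -lm_q; apply: irreducible_lm_unique sig_mh Et' => //; apply: is_pair_scale.
move: lm_mh nz_mg; rewrite !lm_mulX.
case Ea: (LM g.2) => [a|//]; case Eb: (LM h.2) => [b|//] /= eq_mm _.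
move/Some_inj in eq_mm.
(* Multiplied by [m], the comparison of a s' with b s becomes that of b t' with b t, because m a =
   m' b. *)
have lt_gh : pair_lt ltm lts g h.
  have smul_s : smul m (smul b s) = smul b t by rewrite smulA addmC -smulA -def_t.
  have smul_s' : smul m (smul a s') = smul b t'.
    by rewrite smulA -eq_mm addmC -smulA -def_t'.
  by rewrite /pair_lt Ea Eb sig_g sig_h /= -(lts_smul m) smul_s smul_s' lts_smul.
have jp := jpair_pair_lt Ea Eb lt_gh.
(* m a is a common multiple of [a] and [b], so the cofactor of the J-pair divides [m] and its
   signature divides [t]. *)
have le_lcm : (mlcm a b <= m + a)%MM.
  by rewrite lem_mlcm lem_addl -eq_mm lem_addl.
set x := (_, g) in jp; have sig_x : msig lts x = Some (smul x.1 s).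
  by rewrite /msig sig_scaleX sig_g.
have dvd_x : sdvd (smul x.1 s) t.
  rewrite def_t /sdvd /= eqxx /=; apply/mnm_lepP => i.
  have := mnm_lepP le_lcm i; rewrite /x /= !mnmE => le_i.
  by rewrite leq_add2r leq_subLR addnC.
have [|syz|[g' [Dg' dvd_g' better_g']]] := B_jpair Dg Dh jp sig_x.
- exact: B_down Bt (sdvd_ge dvd_x).
- by case: nsyz; apply: syzygy_sig_sdvd syz.
apply/negP: better_g'; apply: best_g Dg' _.
by case: (SIG g') dvd_g' => //= s0 dvd0; apply: sdvd_trans dvd_x.
Qed.

(** An irreducible pair with the leading monomial of [p] has a smaller signature [t]; the best
    divisor of [t] has a multiple equivalent to that pair, and so it top reduces [p]. *)
Lemma reducible_by_best_divisor p s : is_pair f p -> SIG p = Some s ->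
  (forall t, lts t s -> B t) -> ~ irreducible p ->
  exists x t, [/\ best_divisor D better t x.2, msig lts x = Some t, B t,
    ~ syzygy_sig t & top_reducible_mul ltm lts p x].
Proof.
move=> pair_p sig_p B_lt nirr.
have nz_p : LM p.2 != None.
  by case: (not_irreducibleP nirr) => r _ /and4P[].
have [q [pair_q irr_q lm_q le_q]] := irreducible_below pair_p nz_p.
case sig_q: (SIG q) => [t|]; last first.
  by move/(pair_sig_None pair_q): sig_q lm_q nz_p => -> <-; rewrite lm0.
have lt_ts : lts t s.
  have [/eqP eq_sig|] := eqVneq (SIG q) (SIG p).
    by case: nirr; apply: (irreducible_equivp _ lm_q irr_q); apply/eqP.
  by case/(olt_total lts_tot)/orP; [rewrite sig_q sig_p | rewrite (negPf le_q)].
have Bt := B_lt t lt_ts; have nz_q : LM q.2 != None by rewrite lm_q.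
have nsyz := irreducible_nonsyzygy pair_q irr_q nz_q sig_q.
have [g best_g] := best_divisor_exists Bt nsyz.
have [Dg dvd_g _] := best_g; have [pair_g _ _] := D_good Dg.
case sig_g: (SIG g) dvd_g => [s'|//] dvd_s't.
have irr_mg := best_divisor_irreducible Bt nsyz best_g sig_g.
have sig_mg : msig lts ((t.1 - s'.1)%MM, g) = Some t.
  by rewrite /msig sig_scaleX sig_g /= -(elimT (sdvdP _ _) dvd_s't).
have lm_mg : LM (value ((t.1 - s'.1)%MM, g)).2 = LM p.2.
  by rewrite -lm_q; apply: irreducible_lm_unique sig_mg sig_q => //; apply: is_pair_scale.
exists ((t.1 - s'.1)%MM, g), t; split=> //; rewrite /top_reducible_mul lm_mg eqxx andbT.
apply/(top_reducibleP _ pair_g); move: lm_mg nz_p; rewrite lm_mulX.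
case Eb: (LM g.2) => [b|] //= => [<- _|<-//]; exists ((t.1 - s'.1) + b)%MM, b, s'.
split=> //; first exact: lem_addl.
by rewrite addmK sig_p /= -(elimT (sdvdP _ _) dvd_s't).
Qed.

(** Top reductions keep the signature. A result still reducible would be reducible by a best
    divisor, which [ok] admits, so the process would not have stopped. *)
Lemma exhaustive_reductionP (ok : pred (mpair_t K n d)) p q s :
    is_pair f p -> SIG p = Some s -> (forall t, lts t s -> B t) ->
    (forall x t, best_divisor D better t x.2 -> msig lts x = Some t -> B t ->
       ~ syzygy_sig t -> ok x) ->
    exhaustive_reduction ltm lts ok D p q ->
  composed_of_top_reductions ltm lts f p q /\
  [/\ is_pair f q, irreducible q & SIG q = Some s].
Proof.
move=> pair_p sig_p B_lt ok_best [red_pq stop].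
have {red_pq} [comp [pair_q sig_q]] : composed_of_top_reductions ltm lts f p q /\
    (is_pair f q /\ SIG q = SIG p).
  elim: red_pq pair_p {sig_p stop} => [p1 p2 [x [Dx /andP[red_x _] _ ->]]|p1|p1 p2 p3 _ IH1 _ IH2] pair_p1.
  - have [pair_x _ _] := D_good Dx; have [sig_red _] := top_reductionP pair_x red_x.
    by split; [apply: rt_step; exists x.2 | split=> //; apply: is_pair_top_reduction].
  - by split; [apply: rt_refl |].
  have [c12 [pair_p2 sig_p2]] := IH1 pair_p1; have [c23 [pair_p3 sig_p3]] := IH2 pair_p2.
  by split; [apply: rt_trans c12 c23 | rewrite sig_p3].
split=> //; rewrite sig_q; split=> //; apply: NNPP => nirr.
rewrite sig_p in sig_q.
have [x [t [best_x sig_x Bt nsyz red_x]]] :=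
  reducible_by_best_divisor pair_q sig_q B_lt nirr.
apply: (stop (top_reduction ltm q x.2)); exists x; split=> //.
  by case: best_x.
exact: ok_best sig_x Bt nsyz.
Qed.

(** The multiple of the best divisor [g] with signature [t] is equivalent to [p]. Hence [g] is
    similar to [p], and the minimality of [p] in its similar set makes the cofactor 1. *)
Lemma TRB_pair_found p t : TRB_pair ltm lts f p -> SIG p = Some t -> B t ->
  exists2 g, g \in D & equivp ltm lts p g.
Proof.
move=> [[pair_p nz_p irr_p] min_p] sig_p Bt.
have nsyz := irreducible_nonsyzygy pair_p irr_p nz_p sig_p.
have [g best_g] := best_divisor_exists Bt nsyz.
have [Dg dvd_g _] := best_g; have [pair_g irr_g _] := D_good Dg.
case sig_g: (SIG g) dvd_g => [s|//] dvd_st.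
have irr_mg := best_divisor_irreducible Bt nsyz best_g sig_g.
have def_t := elimT (sdvdP _ _) dvd_st.
have sig_mg : SIG (value ((t.1 - s.1)%MM, g)) = Some t.
  by rewrite sig_scaleX sig_g /= -def_t.
have lm_mg : LM p.2 = LM (value ((t.1 - s.1)%MM, g)).2.
  by apply: irreducible_lm_unique sig_p sig_mg => //; apply: is_pair_scale.
move: nz_p; rewrite /nonsyzygy lm_mg lm_mulX; case Eb: (LM g.2) => [b|//] _.
have trp_g : TRP_pair ltm lts f g by split; rewrite // /nonsyzygy Eb.
have sim : similar ltm lts g p.
  rewrite /similar lm_mg lm_mulX Eb sig_g sig_p; apply/eqP; congr Some.
  by rewrite [X in smul _ X]def_t smulA addmC.
have := min_p g trp_g sim; rewrite sig_g sig_p dvd_st /= negbK => /eqP[eq_st].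
have sub0 : (t.1 - s.1 = 0)%MM by rewrite eq_st; apply/mnmP => i; rewrite mnmBE mnm0E subnn.
by exists g; rewrite // /equivp lm_mg lm_mulX Eb sig_g sig_p sub0 /= add0m eq_st !eqxx.
Qed.

End RewriteBasis.

(** * J-pairs and Koszul syzygies *)

Lemma value0 p : value (0%MM, p) = p.
Proof. by rewrite /value /pscale mpolyX0 /= scale1r mul1r; case: p. Qed.

Lemma jpairC g h : jpair ltm lts g h = jpair ltm lts h g.
Proof.
rewrite /jpair /similar /pair_lt.
case Ea: (LM g.2) => [a|]; case Eb: (LM h.2) => [b|] //.
rewrite (mlcmC b a) [X in _ = if X then _ else _]eq_sym.
have [//|ne] := eqVneq.
have /orP[lt|lt] := olt_total lts_tot ne; rewrite lt;
  by rewrite (negPf (olt_asym lts_irr lts_trans lt)).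
Qed.

Lemma good_sig g : good_pair g -> exists s, SIG g = Some s.
Proof. by case=> _ _; case: (SIG g) => [s|//] _; exists s. Qed.

(** At the lcm of the leading monomials the multiple of [g] has the larger signature, so the
    multiple of [h] reduces it. With cofactor 1 the irreducible [g] itself would be reducible. *)
Lemma jpair_pair_ltP g h a b : good_pair g -> good_pair h ->
    LM g.2 = Some a -> LM h.2 = Some b -> pair_lt ltm lts g h ->
  let x := ((mlcm a b - a)%MM, g) in
  [/\ x.1 != 0%MM, top_reducible ltm lts (value x) h,
      olt lts (SIG g) (msig lts x) & olt lts (SIG h) (msig lts x)].
Proof.
move=> good_g good_h Ea Eb lt_gh x.
have [s sig_g] := good_sig good_g; have [t sig_h] := good_sig good_h.
have [pair_g irr_g _] := good_g; have [pair_h irr_h _] := good_h.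
have sig_x : SIG (value x) = Some (smul x.1 s) by rewrite sig_scaleX sig_g.
have lcm_a : (x.1 + a)%MM = mlcm a b by rewrite submK ?lem_mlcml.
have lcm_b := submK (lem_mlcmr a b); set m := (mlcm a b - b)%MM in lcm_b.
have lt_sig : lts (smul m t) (smul x.1 s).
  rewrite -(lts_smul b) smulA addmC lcm_b -lcm_a -smulA.
  rewrite [X in lts _ X]smulA addmC -smulA lts_smul.
  by move: lt_gh; rewrite /pair_lt Ea Eb sig_g sig_h.
have red_x : top_reducible ltm lts (value x) h.
  apply/(top_reducibleP _ pair_h); exists (mlcm a b), b, t.
  by rewrite lm_mulX Ea Eb sig_h sig_x /= lcm_a; split; rewrite ?lem_mlcmr.
have nz_x : x.1 != 0%MM.
  apply: contraTneq red_x => x0.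
  by rewrite /value x0 -/(value (0%MM, g)) value0; apply: irr_g.
split=> //; rewrite /msig sig_x ?sig_g ?sig_h /=.
  by case: adm_s => _ _ _ _ ->.
exact: (@ole_lt_trans _ _ lts_trans lts_tot (Some t) (Some (smul m t)) (Some _))
  (lts_smul_ge m t) lt_sig.
Qed.

Lemma jpairP g h x : good_pair g -> good_pair h -> jpair ltm lts g h = Some x ->
  [/\ x.2 = g \/ x.2 = h, x.1 != 0%MM,
      exists r, [/\ r = g \/ r = h, is_pair f r & top_reducible ltm lts (value x) r]
    & olt lts (SIG g) (msig lts x)].
Proof.
move=> good_g good_h; rewrite /jpair /similar.
case Ea: (LM g.2) => [a|]; case Eb: (LM h.2) => [b|] //.
have [//|ne] := eqVneq; have := olt_total lts_tot ne.
rewrite -Ea -Eb -/(pair_lt ltm lts g h) -/(pair_lt ltm lts h g); case: ifPn => lt_gh.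
  move=> _ [<-]; have [? ? ? ?] := jpair_pair_ltP good_g good_h Ea Eb lt_gh.
  by split; rewrite ?Ea ?Eb; [left| | exists h; split; [right| case: good_h|] |].
move=> /= lt_hg [<-]; have [] := jpair_pair_ltP good_h good_g Eb Ea lt_hg.
rewrite mlcmC => ? ? ? ?.
by split; rewrite ?Ea ?Eb; [right| | exists g; split; [left| case: good_g|] |].
Qed.

Lemma jpairs_in g h x (D : {fset pair}) : h \in D -> jpair ltm lts g h = Some x ->
  x \in jpairs ltm lts g D.
Proof.
move=> Dh jp; rewrite !inE mem_pmap; apply/mapP; by exists h.
Qed.

Lemma jpairs_out g x (D : {fset pair}) : x \in jpairs ltm lts g D ->
  exists2 h, h \in D & jpair ltm lts g h = Some x.
Proof. by rewrite !inE mem_pmap => /mapP[h Dh ->]; exists h. Qed.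

Lemma jpair_diag g : jpair ltm lts g g = None.
Proof. by rewrite /jpair /similar eqxx; case: (LM g.2). Qed.

(** The difference of the two products has polynomial part 0, and the larger of two distinct
    signatures survives in it. *)
Lemma koszul_syzygy_sig q1 q2 s : is_pair f q1 -> is_pair f q2 ->
  let s1 := SIG (pscale q2.2 q1) in let s2 := SIG (pscale q1.2 q2) in
  s1 != s2 -> omax lts s1 s2 = Some s -> syzygy_sig s.
Proof.
move=> pair1 pair2 s1 s2 ne12; rewrite /omax; case: ifPn => lt12 Es.
  exists (pscale q1.2 q2 - pscale q2.2 q1); first by apply: is_pairB; apply: is_pair_scale.
  by split; [rewrite /= mulrC subrr | apply: (lmv_sub_lt Es); rewrite -Es].
exists (pscale q2.2 q1 - pscale q1.2 q2); first by apply: is_pairB; apply: is_pair_scale.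
split; [by rewrite /= mulrC subrr | apply: (lmv_sub_lt Es)].
by have := olt_total lts_tot ne12; rewrite (negPf lt12) -Es.
Qed.

Lemma gsyzygy_dividesP (D : {fset pair}) t : (forall g, g \in D -> good_pair g) ->
  gsyzygy_divides ltm lts D (Some t) -> syzygy_sig t.
Proof.
move=> D_good /orP[/existsP[q /andP[]]|/existsP[q1 /existsP[q2 /andP[ne12]]]].
  rewrite /nonsyzygy negbK lm_eq0 => /eqP q2.
  case sig_q: (SIG _) => [s|//] /= dvd_st; apply: syzygy_sig_sdvd dvd_st _.
  by exists (val q) => //; case: (D_good _ (valP q)).
case Es: (omax _ _ _) => [s|//] dvd_st; apply: syzygy_sig_sdvd dvd_st _.
by apply: koszul_syzygy_sig ne12 Es; [case: (D_good _ (valP q1)) | case: (D_good _ (valP q2))].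
Qed.

(** * Principal syzygies for signature orders that extend the monomial order *)

Section Compatible.
Hypothesis lts_compat : forall m1 m2 i, ltm m1 m2 -> lts (m1, i) (m2, i).

Lemma lts_compat_le m1 m2 i : ~~ ltm m1 m2 -> ~~ lts (m1, i) (m2, i).
Proof.
have [->|/ltm_tot/orP[-> //|/lts_compat lt _]] := eqVneq m1 m2; first by rewrite lts_irr.
exact: (@olt_asym _ _ lts_irr lts_trans (Some _) (Some _) (lt i)).
Qed.

Lemma msupport_mul v1 v2 m : msupport (v1 * v2) m ->
  exists m1 m2, [/\ msupport v1 m1, msupport v2 m2 & m = (m1 + m2)%MM].
Proof.
rewrite /msupport -mcoeff_msupp => /msuppM_le/allpairsP[[m1 m2] [/= s1 s2 ->]].
by exists m1, m2; rewrite -!mcoeff_msupp.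
Qed.

Lemma sig_scale_initial v m i : LM v = Some m ->
  SIG (pscale v (initial_pair f i)) = Some (m, i).
Proof.
move=> lm_v; apply: (lead_unique lts_tot (lmvP _)).
have supp (s : smon n d) : smsupport (v *: delta_mx 0 i) s = (s.2 == i) && msupport v s.1.
  rewrite /smsupport /msupport !mxE eqxx /=.
  by have [_|_] := eqVneq s.2 i; rewrite ?mulr1 // mulr0 mcoeff0 eqxx.
split=> [|[m' j]]; first by rewrite supp eqxx; apply: lm_coeff lm_v.
rewrite supp /= => /andP[/eqP-> /(lead_ge (lmP v))]; rewrite lm_v.
exact: lts_compat_le.
Qed.

(** By compatibility, every monomial of the scaled vector is at most lm(v) sig(p). *)
Lemma sig_scale_lt v p s : olt lts (osmul (LM v) (SIG p)) (Some s) ->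
  olt lts (SIG (pscale v p)) (Some s).
Proof.
move=> lt_s; apply: (lead_lt (lmvP _)) => -[m j].
rewrite /smsupport /= mxE => /msupport_mul[m1 [m2 [s1 s2 ->]]].
have := lead_ge (lmP v) s1; have := @lead_ge _ _ _ _ (m2, j) (lmvP p.1) s2.
rewrite -/(SIG p); case Ea: (LM v) lt_s => [a|//]; case Es: (SIG p) => [[b k]|//] /= lt_s.
move=> le_b le_a.
suff le_m : ~~ lts (smul a (b, k)) (smul m1 (m2, j)).
  exact: (@ole_lt_trans _ _ lts_trans lts_tot (Some _) (Some _) (Some _) le_m lt_s).
have le_m1 : ~~ lts (smul a (m2, j)) (smul m1 (m2, j)).
  by rewrite /smul /= -(addmC m2) -(addmC m2) -!/(smul m2 (_, j)) lts_smul lts_compat_le.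
apply: contra le_m1 => lt1.
apply: (@ole_lt_trans _ _ lts_trans lts_tot (Some _) (Some _) (Some _)) lt1.
by rewrite /= lts_smul.
Qed.

(** For q = (u, v), the syzygy is v (E_i, f_i) - f_i q. The hypothesis bounds the signature of the
    second product by lm(v) E_i, the signature of the first. This justifies the syzygy criteria of
    TRB-F5 and TRB-EF5. *)
Lemma initial_syzygy_sig q a i : is_pair f q -> LM q.2 = Some a ->
  pair_lt ltm lts (initial_pair f i) q -> syzygy_sig (a, i).
Proof.
move=> pair_q lm_q; rewrite /pair_lt lm_q sig_initial /osmul /smul /= addm0 => lt_ai.
exists (pscale q.2 (initial_pair f i) - pscale (f i) q).
  by apply: is_pairB; apply: is_pair_scale => //; apply: is_pair_initial.
split; first by rewrite /= mulrC subrr.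
apply: lmv_sub_lt (sig_scale_lt lt_ai); exact: sig_scale_initial.
Qed.

End Compatible.

(** * The invariant of TRB-EF5 and TRB-GVW *)

Definition below (T : {fset mpair_t K n d}) t : Prop :=
  forall y, y \in T -> olt lts (Some t) (msig lts y).

Lemma below_down T s t : below T t -> ~~ lts t s -> below T s.
Proof.
move=> below_t le_st y Ty.
exact: (@ole_lt_trans _ _ lts_trans lts_tot (Some s) (Some t)) (below_t y Ty).
Qed.

Lemma below_selected (T : {fset mpair_t K n d}) (x : mpair_t K n d) s t :
  (forall y, y \in T -> ~~ olt lts (msig lts y) (msig lts x)) ->
  msig lts x = Some s -> lts t s -> below T t.
Proof.
move=> min_x sig_x lt_ts y Ty.
by apply: (olt_le_trans lts_trans lts_tot) (min_x y Ty); rewrite sig_x.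
Qed.

Definition initial_or_reducible p : Prop :=
  (exists i, p = initial_pair f i) \/
  exists2 r, is_pair f r & top_reducible ltm lts p r.

Lemma irreducible_composed p q :
  composed_of_top_reductions ltm lts f p q -> irreducible p -> q = p.
Proof.
elim=> [p1 p2 [r [pair_r red _]] irr|//|p1 p2 p3 _ IH1 _ IH2 irr].
  by have := irr r pair_r; rewrite red.
have eq12 := IH1 irr; rewrite -eq12; apply: IH2; by rewrite eq12.
Qed.

(** If [q] were equivalent to its input, the input would be irreducible, hence unchanged by the
    reductions. A reducible input is excluded, and an initial one is exempt from blocking. *)
Lemma general_blocksN x q : initial_or_reducible (value x) ->
  composed_of_top_reductions ltm lts f (value x) q -> irreducible q ->
  ~ general_blocks ltm lts f x q.
Proof.
move=> ok_x comp irr_q /andP[/existsPn ninit /andP[/eqP eq_sig /eqP eq_lm]].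
have irr_x := irreducible_equivp eq_sig eq_lm irr_q.
case: ok_x => [[i def_x]|[r pair_r red]].
  by have := ninit i; rewrite (irreducible_composed comp irr_x) def_x eqxx.
by have := irr_x r pair_r; rewrite red.
Qed.

Section Invariant.
Variable better : rel pair.
Implicit Types (D : {fset pair}) (T : {fset mpair_t K n d}) (x : mpair_t K n d).

Definition todo_ok D x : Prop :=
  (exists i, x = (0%MM, initial_pair f i)) \/
  [/\ x.2 \in D, x.1 != 0%MM & exists2 r, is_pair f r & top_reducible ltm lts (value x) r].

Definition initial_handled D i : Prop :=
  syzygy_sig (0%MM, i) \/ exists2 g, g \in D & SIG g = Some (0%MM, i).

Definition rewritable D x : Prop := forall s, msig lts x = Some s ->
  syzygy_sig s \/ exists g, [/\ g \in D, osdvd (SIG g) (Some s) & better g x.2].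

Definition invariant D T : Prop :=
  [/\ forall g, g \in D -> good_pair g,
      forall x, x \in T -> todo_ok D x,
      forall i, (0%MM, initial_pair f i) \in T \/ initial_handled D i
    & forall g h x, g \in D -> h \in D -> jpair ltm lts g h = Some x ->
        x \in T \/ rewritable D x].

Definition handled D x : Prop :=
  (forall i, x = (0%MM, initial_pair f i) -> initial_handled D i) /\
  (x.1 != 0%MM -> rewritable D x).

Lemma initial_handled_sub D D' i : {subset D <= D'} ->
  initial_handled D i -> initial_handled D' i.
Proof. by move=> sub [|[g /sub Dg sig_g]]; [left | right; exists g]. Qed.

Lemma rewritable_sub D D' x : {subset D <= D'} -> rewritable D x -> rewritable D' x.
Proof.
move=> sub rw s /rw[|[g [/sub Dg dvd_g bg]]]; [by left | by right; exists g].
Qed.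

Lemma todo_ok_value D x : (forall g, g \in D -> good_pair g) -> todo_ok D x ->
  [/\ is_pair f (value x), exists s, msig lts x = Some s & initial_or_reducible (value x)].
Proof.
move=> D_good [[i ->]|[/D_good good_x _ red]].
  rewrite /msig value0 sig_initial; split; [exact: is_pair_initial | by eexists |].
  by left; exists i.
have [s sig_x] := good_sig good_x; rewrite /msig sig_scaleX sig_x; split.
- by apply: is_pair_scale; case: good_x.
- by eexists.
by right.
Qed.

Lemma invariant_initial : invariant fset0 [fset (0%MM, initial_pair f i) | i in 'I_d].
Proof.
split=> // [x /imfsetP[i _ ->]|i]; first by left; exists i.
by left; apply/imfsetP; exists i.
Qed.

Lemma invariant_drop D T x : invariant D T -> handled D x -> invariant D (T `\ x).
Proof.
case=> D_good T_ok init jp [handled_i handled_j]; split=> //.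
- by move=> y; rewrite !inE => /andP[_ /T_ok].
- move=> i; have [|] := init i; last by right.
  have [def_x _|ne Ti] := eqVneq (0%MM, initial_pair f i) x; last by left; rewrite !inE ne.
  by right; apply: handled_i.
move=> g h y Dg Dh jp_y; have [|] := jp g h y Dg Dh jp_y; last by right.
have [eq_yx _|ne Ty] := eqVneq y x; last by left; rewrite !inE ne.
right; rewrite eq_yx; apply: handled_j; rewrite -eq_yx.
by have [] := jpairP (D_good _ Dg) (D_good _ Dh) jp_y.
Qed.

Lemma invariant_store D T x q : invariant D T -> good_pair q -> handled (q |` D) x ->
  invariant (q |` D) ((T `\ x) `|` jpairs ltm lts q D).
Proof.
case=> D_good T_ok init jp good_q [handled_i handled_j].
have sub : {subset D <= q |` D} by move=> g Dg; rewrite !inE Dg orbT.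
have D'_good g : g \in q |` D -> good_pair g.
  by rewrite !inE => /predU1P[->|/D_good].
have jp_q h y : h \in q |` D -> jpair ltm lts q h = Some y ->
    y \in (T `\ x) `|` jpairs ltm lts q D.
  rewrite in_fset1U => /predU1P[->|Dh jp_y]; first by rewrite jpair_diag.
  by rewrite in_fsetU (jpairs_in Dh jp_y) orbT.
split=> //.
- move=> y; rewrite in_fsetU => /orP[|/jpairs_out[h Dh jp_y]].
    rewrite !inE => /andP[_ /T_ok[|[/sub Dy nz red]]]; [by left | by right].
  have [or_y nz [r [_ pair_r red]] _] := jpairP good_q (D_good _ Dh) jp_y.
  by right; split=> //; [case: or_y => ->; rewrite !inE ?eqxx ?Dh ?orbT | exists r].
- move=> i; have [|/(initial_handled_sub sub)] := init i; last by right.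
  have [def_x _|ne Ti] := eqVneq (0%MM, initial_pair f i) x; last by left; rewrite !inE ne Ti.
  by right; apply: handled_i.
move=> g h y; rewrite in_fset1U => /predU1P[-> D'h jp_y|Dg].
  by left; apply: jp_q jp_y.
rewrite in_fset1U => /predU1P[->|Dh jp_y].
  by rewrite jpairC => jp_y; left; apply: jp_q jp_y; apply: sub.
have [|/(rewritable_sub sub)] := jp g h y Dg Dh jp_y; last by right.
have [eq_yx _|ne Ty] := eqVneq y x; last by left; rewrite !inE ne Ty.
right; rewrite eq_yx; apply: handled_j; rewrite -eq_yx.
by have [] := jpairP (D_good _ Dg) (D_good _ Dh) jp_y.
Qed.

Section Consequences.
Variables (D : {fset pair}) (T : {fset mpair_t K n d}).
Hypotheses (better_irr : irreflexive better) (better_trans : transitive better).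
Hypothesis inv : invariant D T.

Lemma invariant_B_initial i : below T (0%MM, i) -> initial_handled D i.
Proof.
case: inv => _ _ /(_ i)[Ti _ /(_ _ Ti)|//].
by rewrite /msig value0 sig_initial /= lts_irr.
Qed.

Lemma invariant_B_jpair g h x s : g \in D -> h \in D ->
  jpair ltm lts g h = Some x -> msig lts x = Some s -> below T s ->
  syzygy_sig s \/ exists g', [/\ g' \in D, osdvd (SIG g') (Some s) & better g' x.2].
Proof.
case: inv => _ _ _ jp Dg Dh jp_x sig_x below_s.
have [Tx|] := jp g h x Dg Dh jp_x; last exact.
by have := below_s x Tx; rewrite sig_x /= lts_irr.
Qed.

Lemma invariant_reduction (ok : pred (mpair_t K n d)) x q :
    x \in T -> (forall y, y \in T -> ~~ olt lts (msig lts y) (msig lts x)) ->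
    (forall y t, best_divisor D better t y.2 -> msig lts y = Some t ->
       ~ syzygy_sig t -> ok y) ->
    exhaustive_reduction ltm lts ok D (value x) q ->
  composed_of_top_reductions ltm lts f (value x) q /\
  [/\ is_pair f q, irreducible q & SIG q = msig lts x].
Proof.
move=> Tx min_x ok_best red; have [D_good T_ok _ _] := inv.
have [pair_x [s sig_x] _] := todo_ok_value D_good (T_ok x Tx); rewrite sig_x.
apply: (exhaustive_reductionP better_irr better_trans D_good (@below_down T)
  invariant_B_initial invariant_B_jpair pair_x sig_x _ _ red).
  by move=> t; apply: below_selected min_x sig_x.
by move=> y t best_y sig_y _ nsyz; apply: ok_best best_y sig_y nsyz.
Qed.

End Consequences.

Lemma invariant_regular D p : irreflexive better -> transitive better ->
  invariant D fset0 -> TRB_pair ltm lts f p -> exists2 q, q \in D & equivp ltm lts p q.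
Proof.
move=> better_irr better_trans inv TRB_p; have [[pair_p nz_p _] _] := TRB_p.
case sig_p: (SIG p) => [t|]; last first.
  by move/(pair_sig_None pair_p): sig_p nz_p; rewrite /nonsyzygy => ->; rewrite lm0.
have [D_good _ _ _] := inv.
exact: (TRB_pair_found better_irr better_trans D_good (@below_down fset0)
  (invariant_B_initial inv) (invariant_B_jpair inv) TRB_p sig_p).
Qed.

End Invariant.

Notation stateof A := (@state K n d (memory A)).

(** * Induction along executions *)

Section Execution.
Variable A : @algorithm K n d.
Variable I : stateof A -> Prop.
Hypothesis I_initial : I (initial_state f A).
Hypothesis I_step : forall (s s' : stateof A), I s -> step ltm lts s s' -> I s'.

Lemma reachable_ind (s : stateof A) : reachable ltm lts f s -> I s.
Proof.
rewrite /reachable => run.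
suff : I (initial_state f A) -> I s by apply.
elim: run => [s1 s2 st I1|//|s1 s2 s3 _ IH1 _ IH2 /IH1/IH2 //].
exact: I_step I1 st.
Qed.

End Execution.

(** * TRB-EF5 *)

Section EF5.
Hypothesis lts_compat : forall m1 m2 i, ltm m1 m2 -> lts (m1, i) (m2, i).
Notation A := (TRB_EF5 ltm lts f).

Definition larger_sig : rel pair := fun g h => olt lts (SIG h) (SIG g).

Lemma larger_sig_irr : irreflexive larger_sig.
Proof. by move=> g; apply: olt_irr lts_irr _. Qed.

Lemma larger_sig_trans : transitive larger_sig.
Proof. by move=> g h k lt_gh lt_kg; apply: (olt_trans lts_trans) lt_kg lt_gh. Qed.

Lemma esyzygy_criterionP (D : {fset pair}) x t : (forall g, g \in D -> good_pair g) ->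
  esyzygy_criterion ltm lts f D x -> msig lts x = Some t -> syzygy_sig t.
Proof.
move=> D_good /existsP[q /existsP[i /andP[lt_iq]]] + sig_x; rewrite sig_x.
have [pair_q _ _] := D_good _ (valP q).
case Ea: (LM _) => [a|//]; rewrite /osmul /smul /= addm0 => dvd_as.
exact: syzygy_sig_sdvd dvd_as (initial_syzygy_sig lts_compat pair_q Ea lt_iq).
Qed.

Notation inv s := (invariant larger_sig (DONE s) (TODO s)).

Lemma EF5_reduction (s s1 : stateof A) x q : inv s -> reduces_to lts (A := A) s s1 x q ->
  composed_of_top_reductions ltm lts f (value x) q /\
  [/\ is_pair f q, irreducible q & SIG q = msig lts x].
Proof.
move=> inv_s [/= -> [Tx min_x] _ red]; have [D_good _ _ _] := inv_s.
apply: (invariant_reduction larger_sig_irr larger_sig_trans inv_s) red => //.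
move=> y t [Dy dvd_y best_y] sig_y nsyz; rewrite /EF5_criterions negb_or.
apply/andP; split; first by apply/negP => /(esyzygy_criterionP D_good)/(_ sig_y).
(* Meeting the ERewritten Criterion would contradict that [y.2] has the largest signature among the
   stored divisors. *)
apply/existsPn => g; rewrite negb_and -implybE; apply/implyP; rewrite sig_y => dvd_g.
exact: best_y (valP g) dvd_g.
Qed.

Lemma EF5_handled (s : stateof A) x : inv s -> x \in TODO s ->
  EF5_criterions ltm lts f s x -> handled larger_sig (DONE s) x.
Proof.
move=> [D_good T_ok _ _] Tx crit; split=> [i def_x|nz s0 sig_x].
  have sig_x : msig lts x = Some (0%MM, i) by rewrite /msig def_x value0 sig_initial.
  case/orP: crit => [/(esyzygy_criterionP D_good)/(_ sig_x)|/existsP[g /andP[]]]; first by left.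
  (* Only E_i divides E_i, so the rewriting element already has signature E_i. *)
  rewrite sig_x; case sig_g: (SIG (val g)) => [t|//] dvd_t _; right; exists (val g).
    exact: valP.
  by rewrite sig_g (sdvd_initial dvd_t).
case/orP: crit => [/(esyzygy_criterionP D_good)/(_ sig_x)|/existsP[g /andP[]]]; first by left.
by rewrite sig_x => dvd_g lt_g; right; exists (val g); split=> //; apply: valP.
Qed.

Lemma EF5_step (s s' : stateof A) : inv s -> step ltm lts (A := A) s s' -> inv s'.
Proof.
move=> inv_s; case=> [s1 x /= -> [Tx _] crit|s1 x q red_x blk|s1 x q red_x _] /=.
- by apply: invariant_drop => //; apply: EF5_handled.
- have [eq_s1 [Tx _] _ _] := red_x; have [comp [_ irr_q _]] := EF5_reduction inv_s red_x.
  have [D_good T_ok _ _] := inv_s; rewrite /= in eq_s1; rewrite eq_s1 in Tx.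
  have [_ _ ok_x] := todo_ok_value D_good (T_ok x Tx).
  by case: (general_blocksN ok_x comp irr_q blk).
have [comp [pair_q irr_q sig_q]] := EF5_reduction inv_s red_x.
case: red_x => /= -> [Tx _] _ _; have [D_good T_ok _ _] := inv_s.
have [_ [t sig_x] _] := todo_ok_value D_good (T_ok x Tx).
rewrite sig_x in sig_q; apply: invariant_store => //; first by split; rewrite ?sig_q.
split=> [i def_x|nz u].
  right; exists q; rewrite ?inE ?eqxx //.
  by rewrite sig_q -sig_x /msig def_x value0 sig_initial.
rewrite sig_x => -[<-]; right; exists q; split; [exact: fset1U1 | by rewrite sig_q /= sdvd_refl |].
(* The cofactor of a J-pair differs from 1, so its signature, shared by [q], exceeds that of its
   component. *)
rewrite /larger_sig sig_q -sig_x /msig sig_scaleX.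
case: (T_ok x Tx) nz => [[i ->]|[/D_good/good_sig[v ->] _ _] nz /=]; first by rewrite eqxx.
by case: adm_s => _ _ _ _; apply.
Qed.

Lemma EF5_regular : regular_TRB_algorithm ltm lts f A.
Proof.
have inv_reachable (s : stateof A) : reachable ltm lts f (A := A) s -> inv s.
  exact: (@reachable_ind A (fun st => inv st) (invariant_initial _) EF5_step).
split=> [s s1 x q /inv_reachable inv_s red_x|s /inv_reachable inv_s T0 p].
  by have [comp []] := EF5_reduction inv_s red_x.
rewrite T0 in inv_s; exact: invariant_regular larger_sig_irr larger_sig_trans inv_s.
Qed.

End EF5.

(** * TRB-GVW *)

Section GVW.
Notation A := (TRB_GVW ltm lts : @algorithm K n d).

(* [g] beats [h] when [lm(g)/sig(g)] is smaller than [lm(h)/sig(h)], for two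
   signatures with the same index. *)
Definition smaller_ratio : rel pair := fun g h =>
  if (LM g.2, SIG g, LM h.2, SIG h) is (Some a, Some s, Some b, Some t)
  then ltm (a + t.1)%MM (b + s.1)%MM else false.

Lemma smaller_ratio_irr : irreflexive smaller_ratio.
Proof.
by move=> g; rewrite /smaller_ratio; case: (LM g.2) => // a; case: (SIG g) => // s; rewrite ltm_irr.
Qed.

Lemma smaller_ratio_trans : transitive smaller_ratio.
Proof.
move=> h g k; rewrite /smaller_ratio.
case: (LM g.2) (SIG g) (LM h.2) (SIG h) (LM k.2) (SIG k) => [a|//] [s|//] [b|] [t|] [c|] [u|] // lt1 lt2.
(* Cross-multiplied fractions are chained after multiplication by the monomial of the middle
   signature. *)
rewrite -(ltm_add2l t.1).
have -> : (t.1 + (a + u.1) = u.1 + (a + t.1))%MM by apply/mnmP => i; rewrite !mnmDE; lia.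
have -> : (t.1 + (c + s.1) = s.1 + (c + t.1))%MM by apply/mnmP => i; rewrite !mnmDE; lia.
apply: (@ltm_trans (u.1 + (b + s.1))%MM); first by rewrite ltm_add2l.
have -> : (u.1 + (b + s.1) = s.1 + (b + u.1))%MM by apply/mnmP => i; rewrite !mnmDE; lia.
by rewrite ltm_add2l.
Qed.

Notation inv s := (invariant smaller_ratio (DONE s) (TODO s)).

(** What remains of a signature once a reduction result has been stored or blocked; [passed_covered]
    records this for the Signature Criterion. *)
Definition covered (D : {fset pair}) t : Prop :=
  exists x, [/\ x.2 \in D, msig lts x = Some t & irreducible (value x)].

Definition passed_covered (D : {fset pair}) (passed : seq (mpair_t K n d)) : Prop :=
  forall y t, y \in passed -> msig lts y = Some t -> syzygy_sig t \/ covered D t.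

(** For a J-pair, the value is reducible, while the covering multiple with the same signature is not
    and so has a strictly smaller leading monomial. The ratio of leading monomial to signature is
    unchanged by multiplication, hence [g] beats the component of [x]. *)
Lemma covered_handled D x t : (forall g, g \in D -> good_pair g) -> todo_ok D x ->
  msig lts x = Some t -> syzygy_sig t \/ covered D t -> handled smaller_ratio D x.
Proof.
move=> D_good ok_x sig_x [syz|[[m g] [/= Dg sig_mg irr_mg]]].
  split=> [i def_x|_ u sig_xu]; left.
    by move: sig_x syz; rewrite /msig def_x value0 sig_initial => -[->].
  by move: sig_xu; rewrite sig_x => -[<-].
have [pair_g _ _] := D_good g Dg; have [v sig_g] := good_sig (D_good g Dg).
move: (sig_mg); rewrite /msig sig_scaleX sig_g => -[/= def_t].
split=> [i def_x|nz_x u sig_xu].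
  right; exists g => //; rewrite sig_g -(@sdvd_initial v i) //.
  have [<-] : Some t = Some (0%MM, i) by rewrite -sig_x /msig def_x value0 sig_initial.
  by rewrite -def_t sdvd_smul.
move: sig_xu; rewrite sig_x => -[<- {u}].
have [syz|nsyz] := classic (syzygy_sig t); [by left | right].
exists g; split; rewrite ?sig_g //=; first by rewrite -def_t sdvd_smul.
case: ok_x nz_x => [[i ->]|[Dx _ [r pair_r red]] _]; first by rewrite eqxx.
have [pair_x _ _] := D_good _ Dx; have [w sig_w] := good_sig (D_good _ Dx).
have pair_vx : is_pair f (value x) by apply: is_pair_scale.
have pair_mg : is_pair f (value (m, g)) by apply: is_pair_scale.
move: (sig_x); rewrite /msig sig_scaleX sig_w => -[/= def_t'].
have nz_x := nonsyzygy_lm pair_vx sig_x nsyz.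
have nz_g := nonsyzygy_lm pair_mg sig_mg nsyz.
have lt_lm : olt ltm (LM (value (m, g)).2) (LM (value x).2).
  have le_lm := irreducible_min_lm irr_mg pair_mg pair_vx sig_mg sig_x.
  have [/eqP eq_lm|/(olt_total ltm_tot)/orP[//|]] := eqVneq (LM (value (m, g)).2) (LM (value x).2).
    have irr_x : irreducible (value x).
      by apply: irreducible_equivp irr_mg; [exact: etrans sig_mg (esym sig_x) | apply/eqP].
    by have := irr_x r pair_r; rewrite red.
  by rewrite (negPf le_lm).
move: lt_lm nz_x nz_g; rewrite !lm_mulX /smaller_ratio sig_g sig_w.
case: (LM g.2) => [a|//]; case: (LM x.2.2) => [b|//] /= lt_lm _ _.
(* Multiplying by [t], which factors through both signatures, exposes the two leading monomials with
   a common cofactor. *)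
rewrite -(ltm_add2l t.1).
have -> : (t.1 + (a + w.1) = (v.1 + w.1) + (m + a))%MM.
  by rewrite -def_t; apply/mnmP => i; rewrite !mnmDE; lia.
have -> : (t.1 + (b + v.1) = (v.1 + w.1) + (x.1 + b))%MM.
  by rewrite -def_t'; apply/mnmP => i; rewrite !mnmDE; lia.
by rewrite ltm_add2l.
Qed.

Lemma covered_sub D D' t : {subset D <= D'} -> covered D t -> covered D' t.
Proof. by move=> sub [x [/sub Dx sig_x irr_x]]; exists x. Qed.

Definition GVW_invariant (s : stateof A) : Prop :=
  inv s /\ passed_covered (DONE s) (memo s).

Lemma GVW_reduction (s s1 : stateof A) x q :
  GVW_invariant s -> reduces_to lts (A := A) s s1 x q ->
  composed_of_top_reductions ltm lts f (value x) q /\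
  [/\ is_pair f q, irreducible q & SIG q = msig lts x].
Proof.
move=> [inv_s _] [/= -> [Tx min_x] _ red].
exact: (invariant_reduction smaller_ratio_irr smaller_ratio_trans inv_s) red.
Qed.

Lemma GVW_step (s s' : stateof A) :
  GVW_invariant s -> step ltm lts (A := A) s s' -> GVW_invariant s'.
Proof.
move=> I_s; have [inv_s memo_s] := I_s; have [D_good T_ok _ _] := inv_s.
case=> [s1 x /= -> [Tx _] crit|s1 x q red_x blk|s1 x q red_x _] /=.
- split=> //; apply: invariant_drop => //=.
  have [_ [t sig_x] _] := todo_ok_value D_good (T_ok x Tx).
  apply: (covered_handled D_good (T_ok x Tx) sig_x).
  case/orP: crit; first by rewrite sig_x => /(gsyzygy_dividesP D_good); left.
  by case/hasP => y memo_y /eqP sig_y; apply: memo_s memo_y _; rewrite sig_y.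
- have [comp [pair_q irr_q sig_q]] := GVW_reduction I_s red_x.
  have [/= eq_s1 [Tx _] _ _] := red_x; rewrite {}eq_s1 /= in Tx blk *.
  have [_ [t sig_x] _] := todo_ok_value D_good (T_ok x Tx).
  (* The multiple of a stored pair to which the blocked [q] is equivalent is irreducible like
     [q]. *)
  have cov : covered (DONE s) t.
    have [y [Dy /andP[/eqP eq_sig /eqP eq_lm]]] := blk.
    exists y; split=> //; first by rewrite /msig -eq_sig sig_q.
    exact: irreducible_equivp irr_q.
  split=> [|y u].
    apply: invariant_drop => //.
    by apply: covered_handled sig_x (or_intror cov) => //; apply: T_ok.
  rewrite inE => /predU1P[->|/memo_s]; last exact.
  by rewrite sig_x => -[<-]; right.
have [comp [pair_q irr_q sig_q]] := GVW_reduction I_s red_x.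
have [/= eq_s1 [Tx _] _ _] := red_x; rewrite {}eq_s1 /= in Tx *.
have [_ [t sig_x] _] := todo_ok_value D_good (T_ok x Tx).
have sub : {subset DONE s <= q |` DONE s} by move=> g; apply: fset1Ur.
have cov : covered (q |` DONE s) t.
  by exists (0%MM, q); rewrite /msig value0 fset1U1 sig_q.
have good_q : good_pair q by split; rewrite ?sig_q ?sig_x.
split=> [|y u /=].
  apply: invariant_store => //; apply: covered_handled sig_x (or_intror cov).
    by move=> g; rewrite in_fset1U => /predU1P[->|/D_good].
  by case: (T_ok x Tx) => [|[/sub]]; [left | right].
rewrite inE => /predU1P[->|memo_y sig_y]; first by rewrite sig_x => -[<-]; right.
by case: (memo_s y u memo_y sig_y) => [|/(covered_sub sub)]; [left | right].
Qed.

Lemma GVW_regular : regular_TRB_algorithm ltm lts f A.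
Proof.
have inv_reachable (s : stateof A) : reachable ltm lts f (A := A) s -> GVW_invariant s.
  apply: (@reachable_ind A GVW_invariant _ GVW_step).
  by split; first exact: invariant_initial.
split=> [s s1 x q /inv_reachable inv_s red_x|s /inv_reachable[inv_s _] T0 p].
  by have [comp []] := GVW_reduction inv_s red_x.
rewrite T0 in inv_s; exact: invariant_regular smaller_ratio_irr smaller_ratio_trans inv_s.
Qed.

End GVW.

(** * TRB-F5 *)

Section F5.
Hypothesis ltsE : forall s t, lts s t = F5_order ltm s t.
Hypotheses (ltm_hom : homogeneous_order ltm) (f_hom : homogeneous_input f).
Notation A := (TRB_F5 ltm lts f).
Implicit Types (x y : mpair_t K n d) (R : seq pair).

Lemma F5_lts_compat m1 m2 i : ltm m1 m2 -> lts (m1, i) (m2, i).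
Proof. by rewrite ltsE /F5_order /= eqxx => ->; rewrite orbT. Qed.

(** The weak form of the F5 order, read on signatures. Signatures of equal index and degree are
    tied. *)
Definition F5_le s t : bool :=
  (t.2 < s.2)%N || ((s.2 == t.2) && (mdeg s.1 <= mdeg t.1)%N).

Definition oF5_le (u1 u2 : option (smon n d)) : bool :=
  if (u1, u2) is (Some s, Some t) then F5_le s t else false.

Lemma F5_le_trans s1 s2 s3 : F5_le s1 s2 -> F5_le s2 s3 -> F5_le s1 s3.
Proof. by rewrite /F5_le -!val_eqE /=; lia. Qed.

Lemma oF5_le_trans u1 u2 u3 : oF5_le u1 u2 -> oF5_le u2 u3 -> oF5_le u1 u3.
Proof. by case: u1 u2 u3 => [s1|] [s2|] [s3|] //; apply: F5_le_trans. Qed.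

Lemma ltm_mdeg m1 m2 : ltm m1 m2 -> (mdeg m1 <= mdeg m2)%N.
Proof.
move=> lt12; rewrite leqNgt; apply/negP => /ltm_hom lt21.
by have := ltm_trans lt12 lt21; rewrite ltm_irr.
Qed.

Lemma lts_F5_le s t : lts s t -> F5_le s t.
Proof.
rewrite ltsE /F5_le => /orP[->//|/andP[-> /ltm_mdeg ->]]; exact: orbT.
Qed.

Lemma F5_le_refl s : F5_le s s.
Proof. by rewrite /F5_le eqxx leqnn orbT. Qed.

Lemma F5_le_sdvd s t : F5_le s t -> sdvd t s -> s = t.
Proof.
rewrite /F5_le => + dvd_ts; have /eqP e2 : t.2 == s.2 by case/andP: dvd_ts.
rewrite e2 ltnn eqxx /= {1}(elimT (sdvdP _ _) dvd_ts) mdegD => le_deg.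
have /eqP d0 : mdeg (s.1 - t.1)%MM == 0%N by move: le_deg; lia.
move/eqP: d0; rewrite mdeg_eq0 => /eqP d0.
by rewrite (elimT (sdvdP _ _) dvd_ts) d0 smul0m.
Qed.

(** The signature thus determines the degree of the polynomial part, which makes the F5 order of
    values an order on signatures. *)
Definition homog_pair p : Prop := forall s m, SIG p = Some s -> msupport p.2 m ->
  mdeg m = (mdeg s.1 + pdeg ltm (initial_pair f s.2))%N.

Lemma homog_initial i : homog_pair (initial_pair f i).
Proof.
move=> s m; rewrite sig_initial => -[<-] /=; rewrite mdeg0 add0n /msupport /pdeg /=.
have := lmP (f i); case: (LM (f i)) => [a [sa _]|no sm] /=; last by move: (no m); rewrite /msupport sm.
have /homogP[e /dhomogP hom_e] := f_hom i => sm.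
by rewrite (hom_e m) ?(hom_e a) ?mcoeff_msupp.
Qed.

Lemma homog_value m p : homog_pair p -> homog_pair (value (m, p)).
Proof.
move=> hom_p s m'; rewrite sig_scaleX; case sig_p: (SIG p) => [t|//] /= [<-].
by case/msupport_mulX=> m0 /(hom_p _ _ sig_p) deg_m0 ->; rewrite !mdegD deg_m0 addnA.
Qed.

(** The signature of [q] may have another index, so the degrees of [p] and of the subtracted
    multiple are compared through the cancelled leading monomial. *)
Lemma homog_top_reduction p q : is_pair f q -> homog_pair p -> homog_pair q ->
  top_reducible ltm lts p q -> homog_pair (top_reduction ltm p q).
Proof.
move=> pair_q hom_p hom_q red s m; have [-> _] := top_reductionP pair_q red.
case/(top_reducibleP _ pair_q): red => a [b [t [Ea Eb Et le_ba _]]] sig_p.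
rewrite /top_reduction /lt_quot Ea Eb => /msupport_sub/orP[/(hom_p _ _ sig_p) //|].
rewrite /msupport /= -scalerAl mcoeffZ mulf_eq0 negb_or => /andP[_ /msupport_mulX[m0 sm0 ->]].
rewrite mdegD (hom_q _ _ Et sm0) -(hom_q _ _ Et (lm_coeff Eb)) -mdegD submK //.
exact: hom_p sig_p (lm_coeff Ea).
Qed.

Lemma homog_exhaustive_reduction (ok : pred (mpair_t K n d)) (D : {fset pair}) p q :
  (forall g, g \in D -> is_pair f g /\ homog_pair g) ->
  exhaustive_reduction ltm lts ok D p q -> homog_pair p -> homog_pair q.
Proof.
move=> D_ok [red _]; elim: red => [p1 p2 [x [Dx /andP[red _] _ ->]]|//|p1 p2 p3 _ IH1 _ IH2 /IH1/IH2 //].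
by move=> hom_p1; have [pair_x hom_x] := D_ok _ Dx; apply: homog_top_reduction.
Qed.

(** A reducible value has a nonzero polynomial part. A zero one can occur only for an initial pair,
    where [pdeg] takes the same default 0 on both sides of [F5_value_pdeg]. *)
Definition F5_value p : Prop := [/\ is_pair f p, homog_pair p &
  exists2 s, SIG p = Some s & (exists i, p = initial_pair f i) \/
    s.1 != 0%MM /\ exists2 r, is_pair f r & top_reducible ltm lts p r].

Lemma F5_value_pdeg p s : F5_value p -> SIG p = Some s ->
  pdeg ltm p = (mdeg s.1 + pdeg ltm (initial_pair f s.2))%N.
Proof.
case=> _ hom_p [t sig_p ok_p]; rewrite sig_p => -[<-].
case: ok_p => [[i def_p]|[_ [r _ /and4P[nz _ _ _]]]].
  by move: sig_p; rewrite def_p sig_initial => -[<-]; rewrite mdeg0.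
move: nz; rewrite /pdeg /nonsyzygy; case Ea: (LM p.2) => [a|//] _ /=.
exact: hom_p sig_p (lm_coeff Ea).
Qed.

Lemma F5_ltN p q : F5_value p -> F5_value q ->
  ~~ F5_lt ltm lts q p = oF5_le (SIG p) (SIG q).
Proof.
move=> val_p val_q; case: (val_p) (val_q) => _ _ [s sig_p _] [_ _ [t sig_q _]].
rewrite /F5_lt sig_p sig_q (F5_value_pdeg val_p sig_p) (F5_value_pdeg val_q sig_q).
case: s t {sig_p sig_q} => [a i] [b j] /=; rewrite /F5_le /=.
rewrite /oF5_le /F5_le /=.
have [->|ne_ji] := eqVneq j i; first by rewrite !ltnn /= ltn_add2r -leqNgt.
by move: ne_ji; rewrite -val_eqE /=; lia.
Qed.

(** * The list of rules *)

Definition first_rule R u : option pair := ohead [seq r <- R | osdvd (SIG r) u].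

Lemma rewritten_criterionE R x : rewritten_criterion lts R x =
  if first_rule R (msig lts x) is Some r then x.2 != r else false.
Proof. by rewrite /rewritten_criterion /first_rule; case: [seq _ <- _ | _]. Qed.

Lemma first_rule_cons p R u : first_rule (p :: R) u =
  if osdvd (SIG p) u then Some p else first_rule R u.
Proof. by rewrite /first_rule /=; case: ifP. Qed.

Lemma first_rule_mem R u r : first_rule R u = Some r -> r \in R /\ osdvd (SIG r) u.
Proof.
elim: R => // p R IH; rewrite first_rule_cons; case: ifP => [dvd_p [<-]|_ /IH[Rr dvd_r]].
  by rewrite mem_head.
by rewrite inE Rr orbT.
Qed.

Lemma first_rule_index R u r g : first_rule R u = Some r -> osdvd (SIG g) u ->
  (index r R <= index g R)%N.
Proof.
elim: R => [|p R IH]; first by [].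
rewrite first_rule_cons; case: ifP => [_|ndvd Er dvd_g].
  by case=> <- _; rewrite /= eqxx.
rewrite /=; have [def_p|_] := eqVneq p g; first by rewrite def_p dvd_g in ndvd.
by case: (p == r); [exact: leq0n | rewrite ltnS; exact: IH Er dvd_g].
Qed.

Lemma osdvd_refl (u : option (smon n d)) : osdvd u u.
Proof. by case: u => //= s; apply: sdvd_refl. Qed.

(** Equality is allowed because the same pair can be prepended again while it waits as [1, mp]. *)
Definition no_earlier_divisor R : bool :=
  pairwise (fun r r' => osdvd (SIG r) (SIG r') ==> (r == r')) R.

Lemma first_rule_self R r : no_earlier_divisor R -> r \in R ->
  first_rule R (SIG r) = Some r.
Proof.
rewrite /no_earlier_divisor; elim: R => // p R IH /= /andP[/allP p_R pw].
rewrite inE first_rule_cons => /predU1P[->|Rr]; first by rewrite osdvd_refl.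
case: ifP => [dvd_p|_]; last exact: IH.
by have := p_R r Rr; rewrite dvd_p => /eqP->.
Qed.

Lemma first_rule_map (phi : pair -> pair) R u : {in R, forall r, SIG (phi r) = SIG r} ->
  first_rule (map phi R) u = omap phi (first_rule R u).
Proof.
elim: R => // p R IH sig_phi; rewrite /= !first_rule_cons sig_phi ?mem_head //.
by case: ifP => // _; apply: IH => r Rr; apply: sig_phi; rewrite inE Rr orbT.
Qed.

(** A signature of larger index lies below every signature of index [i], so the hypothesis of
    [initial_syzygy_sig] holds by comparison of indices alone. *)
Lemma F5_syzygy_criterionP (D : {fset pair}) x t : (forall g, g \in D -> good_pair g) ->
  F5_syzygy_criterion ltm lts D x -> msig lts x = Some t -> syzygy_sig t.
Proof.
move=> D_good /existsP[q]; have [pair_q _ _] := D_good _ (valP q).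
case: (SIG x.2) => [[b i]|//]; case Eq: (SIG (val q)) => [[c j]|//] /andP[lt_ij] + sig_x.
rewrite sig_x; case Ea: (LM _) => [a|//]; rewrite /osmul /smul /= addm0 => dvd_at.
apply: syzygy_sig_sdvd dvd_at (initial_syzygy_sig F5_lts_compat pair_q Ea _).
rewrite /pair_lt Ea Eq sig_initial /=; case: (LM (f i)) => //= e.
by rewrite ltsE /F5_order /= lt_ij.
Qed.

(** * The invariant of TRB-F5 *)

Notation F5state := (stateof A).

(* A J-pair that has been selected in TODO is represented by [1, mp], with mp in
   Rules.  The rules are ordered by index and degree of their signatures, and
   stay below TODO ([F5_rules_le]); this is where homogeneity is needed. *)
Record F5_invariant (st : F5state) : Prop := F5Invariant {
  F5_done : forall g, g \in DONE st ->
    [/\ good_pair g, homog_pair g & g \in memo st];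
  F5_todo : forall x, x \in TODO st -> F5_value (value x) /\
    [\/ exists i, x = (0%MM, initial_pair f i), x.1 != 0%MM /\ x.2 \in DONE st
      | x.1 = 0%MM /\ x.2 \in memo st];
  F5_initials : forall i, (0%MM, initial_pair f i) \in TODO st \/
    initial_handled (DONE st) i;
  F5_jpairs : forall g h x, g \in DONE st -> h \in DONE st ->
    jpair ltm lts g h = Some x ->
    [\/ x \in TODO st, (0%MM, value x) \in TODO st /\ value x \in memo st,
        forall t, msig lts x = Some t -> syzygy_sig t
      | rewritten_criterion lts (memo st) x];
  F5_pairwise : no_earlier_divisor (memo st);
  F5_rules_le : forall r x, r \in memo st -> x \in TODO st ->
    oF5_le (SIG r) (msig lts x);
  F5_rules : forall r, r \in memo st -> SIG r != None /\
    [\/ r \in DONE st, (0%MM, r) \in TODO st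
      | forall t, SIG r = Some t -> syzygy_sig t];
  F5_fresh : forall x, x \in TODO st -> x.1 = 0%MM -> x.2 \notin DONE st }.

Lemma msig0 p : msig lts (0%MM, p) = SIG p.
Proof. by rewrite /msig value0. Qed.

Lemma F5_invariant_initial : F5_invariant (initial_state f A).
Proof.
split=> //= [x /imfsetP[i _ ->]|i].
  split; last by constructor 1; exists i.
  rewrite value0; split; [exact: is_pair_initial | exact: homog_initial |].
  by exists (0%MM, i); [exact: sig_initial | left; exists i].
by left; apply/imfsetP; exists i.
Qed.

Section Selection.
Variable st : F5state.
Hypothesis inv : F5_invariant st.

Definition earlier : rel pair := fun g h => (index g (memo st) < index h (memo st))%N.

Lemma F5_done_good g : g \in DONE st -> good_pair g.
Proof. by case/(F5_done inv). Qed.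

Lemma F5_rewritten x t : x.2 \in DONE st -> msig lts x = Some t -> below (TODO st) t ->
  rewritten_criterion lts (memo st) x ->
  syzygy_sig t \/
  exists g, [/\ g \in DONE st, osdvd (SIG g) (Some t) & earlier g x.2].
Proof.
move=> Dx sig_x below_t; rewrite rewritten_criterionE.
case Er: (first_rule _ _) => [r|//] ne_xr; have [Rr] := first_rule_mem Er.
rewrite sig_x => dvd_r; have [nN] := F5_rules inv Rr.
case sig_r: (SIG r) dvd_r nN => [u|//] /= dvd_ut _ [Dr|Tr|syz_r]; last 1 first.
- by left; apply: syzygy_sig_sdvd dvd_ut (syz_r u _).
- right; exists r; rewrite sig_r; split=> //; rewrite /earlier ltn_neqAle.
  have [[v sig_v] Rx] : (exists s, SIG x.2 = Some s) /\ x.2 \in memo st.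
    by case: (F5_done inv Dx) => /good_sig.
  rewrite (first_rule_index Er) ?andbT; last first.
    by rewrite /msig sig_scaleX sig_v /= sdvd_smul.
  by apply: contra ne_xr => /eqP eq_idx; rewrite -(nth_index r Rx) -eq_idx nth_index.
have := below_down below_t (sdvd_ge dvd_ut) Tr.
by rewrite msig0 sig_r /= lts_irr.
Qed.

Lemma F5_B_initial i : below (TODO st) (0%MM, i) -> initial_handled (DONE st) i.
Proof.
case: (F5_initials inv i) => [Ti /(_ _ Ti)|//].
by rewrite msig0 sig_initial /= lts_irr.
Qed.

Lemma F5_B_jpair g h x t : g \in DONE st -> h \in DONE st ->
  jpair ltm lts g h = Some x -> msig lts x = Some t -> below (TODO st) t ->
  syzygy_sig t \/
  exists g', [/\ g' \in DONE st, osdvd (SIG g') (Some t) & earlier g' x.2].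
Proof.
move=> Dg Dh jp_x sig_x below_t.
have [Tx|[Tx _]|syz|rw] := F5_jpairs inv Dg Dh jp_x.
- by have := below_t x Tx; rewrite sig_x /= lts_irr.
- by have := below_t _ Tx; rewrite msig0 -/(msig lts x) sig_x /= lts_irr.
- by left; apply: syz.
apply: F5_rewritten sig_x below_t rw.
by have [[->|->]] := jpairP (F5_done_good Dg) (F5_done_good Dh) jp_x.
Qed.

Lemma earlier_irr : irreflexive earlier.
Proof. by move=> g; rewrite /earlier ltnn. Qed.

Lemma earlier_trans : transitive earlier.
Proof. by move=> g h k; apply: ltn_trans. Qed.

Lemma F5_reductionP x q : x \in TODO st ->
    (forall y, y \in TODO st -> ~~ olt lts (msig lts y) (msig lts x)) ->
    reductions (a := A) st (value x) q ->
  composed_of_top_reductions ltm lts f (value x) q /\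
  [/\ is_pair f q, irreducible q, SIG q = msig lts x & homog_pair q].
Proof.
move=> Tx min_x /= red; have [[pair_x hom_x [s sig_x _]] _] := F5_todo inv Tx.
have ok_best y t : best_divisor (DONE st) earlier t y.2 -> msig lts y = Some t ->
    below (TODO st) t -> ~ syzygy_sig t -> ~~ F5_criterions ltm lts st y.
  move=> [Dy dvd_y best_y] sig_y below_t nsyz; rewrite negb_or; apply/andP; split.
    by apply/negP => /(F5_syzygy_criterionP F5_done_good)/(_ sig_y).
  apply/negP => /(F5_rewritten Dy sig_y below_t)[//|[g [Dg dvd_g lt_g]]].
  by have := best_y g Dg dvd_g; rewrite lt_g.
have [comp [pair_q irr_q sig_q]] := exhaustive_reductionP earlier_irr earlier_trans
  F5_done_good (@below_down (TODO st)) F5_B_initial F5_B_jpair pair_x sig_x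
  (fun t => @below_selected _ _ s t min_x sig_x) ok_best red.
split=> //; split; rewrite ?sig_q //.
apply: homog_exhaustive_reduction red hom_x.
by move=> g /(F5_done inv)[[]].
Qed.

End Selection.

(** * The preparation of a selection *)

Definition F5_min (st : F5state) x : Prop :=
  forall y, y \in TODO st -> oF5_le (msig lts x) (msig lts y).

Definition F5_prepared (st : F5state) x : Prop :=
  F5_criterions ltm lts st x \/ x.1 = 0%MM /\ x.2 \in memo st.

Lemma F5_value_sig p : F5_value p -> exists s, SIG p = Some s.
Proof. by case=> _ _ [s sig_p _]; exists s. Qed.

Lemma F5_msig (st : F5state) x : F5_invariant st -> x \in TODO st ->
  exists s, msig lts x = Some s.
Proof. by move=> inv /(F5_todo inv)[/F5_value_sig]. Qed.

Lemma sig_value_ne x s : msig lts x = Some s -> SIG x.2 = Some s -> x.1 = 0%MM.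
Proof.
move=> + sig_x; rewrite /msig sig_scaleX sig_x => /Some_inj/(congr1 (fun t => mdeg t.1)).
by rewrite /= mdegD => e; apply/eqP; rewrite -mdeg_eq0; move: e; lia.
Qed.

Section Replacement.
Variables (st : F5state) (x : mpair_t K n d).
Hypotheses (inv : F5_invariant st) (Tx : x \in TODO st) (min_x : F5_min st x).
Hypothesis crit_x : ~~ F5_criterions ltm lts st x.
Notation R := (memo st).
Notation v := (value x).

(* A rule whose signature is a multiple of that of the new one has the same
   signature, by minimality of the degree; being the first divisor of its own
   signature, it is the pair that the Rewritten Criterion compares with. *)
Lemma F5_rule_multiple r : r \in R -> osdvd (SIG v) (SIG r) ->
  [/\ r = v, x.1 = 0%MM & x.2 = v].
Proof.
move=> Rr dvd_r; have [s sig_x] := F5_msig inv Tx.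
have := F5_rules_le inv Rr Tx; rewrite sig_x /=; rewrite -/(msig lts x) sig_x in dvd_r.
case sig_r: (SIG r) dvd_r => [t|//] dvd_st le_ts.
have eq_ts := F5_le_sdvd le_ts dvd_st.
have fr := first_rule_self (F5_pairwise inv) Rr.
move: crit_x; rewrite /F5_criterions negb_or rewritten_criterionE sig_x => /andP[_].
rewrite -eq_ts -sig_r fr negbK => /eqP def_x2.
have x1 : x.1 = 0%MM by apply: (@sig_value_ne x s sig_x); rewrite def_x2 sig_r eq_ts.
have def_v : v = x.2 by rewrite /value x1 -/(value (0%MM, x.2)) value0.
by rewrite def_v.
Qed.

(** A stored [v] would be a rule, so [F5_rule_multiple] would make [x] equal to [1, v], against
    [F5_fresh]. *)
Lemma F5_value_fresh : v \notin DONE st.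
Proof.
apply/negP => Dv; have [_ _ Rv] := F5_done inv Dv.
have [_ x1 x2] := F5_rule_multiple Rv (osdvd_refl _).
by have := F5_fresh inv Tx x1; rewrite x2 Dv.
Qed.

Let st' : F5state := State (DONE st) ((0%MM, v) |` (TODO st `\ x)) (v :: R).

(** The new rule either becomes the first divisor, and differs from [y.2], or leaves the first
    divisor unchanged. *)
Lemma F5_replace_rewritten y : y.2 != v ->
  rewritten_criterion lts R y -> rewritten_criterion lts (v :: R) y.
Proof. by move=> ne_v; rewrite !rewritten_criterionE first_rule_cons; case: ifP. Qed.

Lemma F5_replace_todo y : y \in TODO st -> y = x \/ y \in TODO st'.
Proof.
move=> Ty; have [->|ne] := eqVneq y x; first by left.
by right; rewrite /= !inE ne Ty orbT.
Qed.

Lemma F5_replace_todo' y : y \in TODO st' -> y = (0%MM, v) \/ y \in TODO st.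
Proof. by rewrite /= !inE => /predU1P[->|/andP[_ Ty]]; [left | right]. Qed.

Lemma F5_replace_new : (0%MM, v) \in TODO st'.
Proof. exact: fset1U1. Qed.

Lemma F5_replace_zero p : (0%MM, p) \in TODO st -> (0%MM, p) \in TODO st'.
Proof.
case/F5_replace_todo => // def_x.
have -> : p = v by rewrite -def_x value0.
exact: F5_replace_new.
Qed.

Lemma F5_replace_invariant : F5_invariant st'.
Proof.
have [val_x _] := F5_todo inv Tx.
split.
- by move=> g /(F5_done inv)[good_g hom_g Rg]; split; rewrite // inE Rg orbT.
- move=> y /F5_replace_todo'[->|/(F5_todo inv)[val_y ok_y]].
    by rewrite value0; split=> //; constructor 3; rewrite mem_head.
  split=> //; case: ok_y => [?|?|[y1 Ry]]; [by constructor 1|by constructor 2|].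
  by constructor 3; rewrite inE Ry orbT.
- by move=> i; case: (F5_initials inv i) => [/F5_replace_zero|]; [left | right].
- move=> g h y Dg Dh jp_y; case: (F5_jpairs inv Dg Dh jp_y) => [|[Ty Ry]|syz|rw].
  + case/F5_replace_todo => [->|]; last by constructor 1.
    by constructor 2; split; [exact: F5_replace_new | exact: mem_head].
  + by constructor 2; split; [exact: F5_replace_zero | rewrite inE Ry orbT].
  + by constructor 3.
  constructor 4; apply: F5_replace_rewritten rw.
  have [or_y _ _ _] := jpairP (F5_done_good inv Dg) (F5_done_good inv Dh) jp_y.
  by apply: contraNneq F5_value_fresh => <-; case: or_y => ->.
- rewrite /no_earlier_divisor /= [pairwise _ _](F5_pairwise inv) andbT.
  by apply/allP => r Rr; apply/implyP => /(F5_rule_multiple Rr)[->].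
- move=> r y; rewrite inE => Rr T'y.
  have [z [Tz sig_z]] : exists z, z \in TODO st /\ msig lts y = msig lts z.
    by case/F5_replace_todo': T'y => [->|Ty]; [exists x; rewrite msig0 | exists y].
  rewrite sig_z; case/predU1P: Rr => [->|Rr]; first exact: min_x.
  exact: F5_rules_le Rr Tz.
- move=> r; rewrite inE => /predU1P[->|/(F5_rules inv)[nN ok_r]].
    split; last by constructor 2; exact: F5_replace_new.
    by have [s ->] := F5_value_sig val_x.
  split=> //; case: ok_r => [Dr|Tr|syz]; [by constructor 1 | | by constructor 3].
  by constructor 2; apply: F5_replace_zero.
by move=> y /F5_replace_todo'[-> _|/(F5_fresh inv)//]; apply: F5_value_fresh.
Qed.

Lemma F5_replace_min y : F5_min st' y -> F5_min st y.
Proof.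
move=> min_y z /F5_replace_todo[->|]; last exact: min_y.
by have := min_y _ F5_replace_new; rewrite msig0.
Qed.

Lemma F5_min_replace y : F5_min st y -> F5_min st' y.
Proof.
move=> min_y z /F5_replace_todo'[->|]; last exact: min_y.
by rewrite msig0; apply: min_y.
Qed.

(** The Rewritten Criterion could be lost only if [y.2] were the new rule. For an initial pair or a
    waiting rule this forces y = x, and a stored pair is excluded by freshness. *)
Lemma F5_replace_criterions y : y \in TODO st -> y <> x ->
  F5_criterions ltm lts st y -> F5_criterions ltm lts st' y.
Proof.
move=> Ty ne_yx /orP[syz|rw]; apply/orP; [by left | right].
apply: F5_replace_rewritten rw; apply/eqP => y2.
case: (F5_todo inv Ty) => _ [[i def_y]|[_ Dy]|[y1 Ry]].
- have [s sig_x] := F5_msig inv Tx.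
  have x1 : x.1 = 0%MM.
    case: (F5_todo inv Tx) => _ [[j -> //]|[nz_x Dx]|[]//].
    have [t sig_x2] := good_sig (F5_done_good inv Dx).
    have : SIG v = Some (0%MM, i) by rewrite -y2 def_y sig_initial.
    rewrite sig_scaleX sig_x2 => /Some_inj/(congr1 (fun t => mdeg t.1)).
    by rewrite /= mdegD mdeg0 => e; apply/eqP; rewrite -mdeg_eq0; move: e; lia.
  apply: ne_yx; rewrite def_y [x]surjective_pairing x1; congr (_, _).
  by rewrite -[x.2]value0 -x1 -surjective_pairing -y2 def_y.
- by have := F5_value_fresh; rewrite -y2 Dy.
rewrite y2 in Ry; have [_ x1 x2] := F5_rule_multiple Ry (osdvd_refl _).
by apply: ne_yx; rewrite [x]surjective_pairing x1 x2 -y2 -y1 -surjective_pairing.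
Qed.

Lemma F5_replace_prepared y : y \in TODO st -> y <> x ->
  F5_prepared st y -> F5_prepared st' y.
Proof.
move=> Ty ne_yx [/(F5_replace_criterions Ty ne_yx)|[y1 Ry]]; first by left.
by right; rewrite inE Ry orbT.
Qed.

End Replacement.

(** Loop invariant: each element of smallest order is still listed or already prepared. A
    replacement keeps the signature, so it does not change which elements are smallest. *)
Lemma F5_foldl_replace (l : seq (mpair_t K n d)) (st : F5state) :
    F5_invariant st -> uniq l ->
    (forall x, x \in l -> x \in TODO st /\ F5_min st x) ->
    (forall x, x \in TODO st -> F5_min st x -> x \in l \/ F5_prepared st x) ->
  let st1 := foldl (F5_replace ltm lts) st l in
  F5_invariant st1 /\
  forall x, x \in TODO st1 -> F5_min st1 x -> F5_prepared st1 x.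
Proof.
elim: l st => [|x l IH] st inv /= => [_ _ prep|/andP[l'x uniq_l] l_min prep].
  by split=> // x Tx /(prep x Tx)[].
have [Tx min_x] := l_min x (mem_head _ _).
rewrite /F5_replace; case: ifPn => crit_x; apply: IH => //.
- by move=> y ly; apply: l_min; rewrite inE ly orbT.
- move=> y Ty /(prep y Ty)[|]; last by right.
  by rewrite inE => /predU1P[->|]; [right; left | left].
- exact: F5_replace_invariant.
- move=> y ly; have [|Ty min_y] := l_min y; first by rewrite inE ly orbT.
  split; last exact: F5_min_replace.
  by case: (F5_replace_todo x Ty) => // eq_yx; rewrite -eq_yx ly in l'x.
move=> y T'y /F5_replace_min min_y.
have [->|ne_y0] := eqVneq y (0%MM, value x).
  by right; right; rewrite mem_head.
have /andP[ne_yx Ty] : (y != x) && (y \in TODO st).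
  by move: T'y; rewrite /= !inE (negPf ne_y0).
case: (prep y Ty min_y) => [|prep_y]; first by rewrite inE (negPf ne_yx); left.
by right; apply: F5_replace_prepared prep_y => //; apply/eqP.
Qed.

Lemma F5_prepareP (st st1 : F5state) : F5_invariant st -> F5_prepare ltm lts st st1 ->
  F5_invariant st1 /\
  forall x, x \in TODO st1 -> F5_min st1 x -> F5_prepared st1 x.
Proof.
move=> inv [l perm_l ->].
have l_mem x : x \in l <-> x \in TODO st /\ F5_min st x.
  rewrite (perm_mem perm_l) mem_filter; split=> [/andP[/allP min_x Tx]|[Tx min_x]].
    split=> // y Ty; rewrite -F5_ltN; first exact: min_x.
      by case: (F5_todo inv Tx).
    by case: (F5_todo inv Ty).
  rewrite Tx andbT; apply/allP => y Ty; rewrite F5_ltN; first exact: min_x.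
    by case: (F5_todo inv Tx).
  by case: (F5_todo inv Ty).
apply: F5_foldl_replace => //.
- by rewrite (perm_uniq perm_l) filter_uniq // fset_uniq.
- by move=> x /l_mem.
by move=> x Tx min_x; left; apply/l_mem.
Qed.

Lemma F5_min_selected (st : F5state) x : F5_invariant st -> x \in TODO st ->
  (forall y, y \in TODO st -> ~~ olt lts (msig lts y) (msig lts x)) -> F5_min st x.
Proof.
move=> inv Tx min_x y Ty; have [s sig_x] := F5_msig inv Tx; have [t sig_y] := F5_msig inv Ty.
have := min_x y Ty; rewrite sig_x sig_y /oF5_le /=.
by have [->|/lts_tot/orP[/lts_F5_le|->//]] := eqVneq s t; rewrite ?F5_le_refl.
Qed.

(** The selected multiplied pair has smallest F5 order, since the signature order refines it, and is
    therefore prepared. As it passes the criteria, it is some [1, mp] with mp in Rules. *)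
Lemma F5_reduces (st st1 : F5state) x q : F5_invariant st ->
    reduces_to lts (A := A) st st1 x q ->
  [/\ F5_invariant st1, x.1 = 0%MM /\ x.2 \in memo st1, F5_min st1 x,
      composed_of_top_reductions ltm lts f (value x) q &
      [/\ is_pair f q, irreducible q, SIG q = msig lts x & homog_pair q]].
Proof.
move=> inv [/= prep [Tx min_x] crit_x red].
have [inv1 prep1] := F5_prepareP inv prep.
have min1 := F5_min_selected inv1 Tx min_x.
have [comp ok_q] := F5_reductionP inv1 Tx min_x red.
split=> //; case: (prep1 x Tx min1) => // crit.
by rewrite crit in crit_x.
Qed.

(** * Discarding a multiplied pair that meets a criterion *)

Section Drop.
Variables (st : F5state) (x : mpair_t K n d).
Hypotheses (inv : F5_invariant st) (Tx : x \in TODO st).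
Hypothesis crit_x : F5_criterions ltm lts st x.

(** A rule is the first divisor of its own signature, so [1, r] never meets the Rewritten Criterion;
    only the Syzygy Criterion can discard it. *)
Lemma F5_drop_syzygy s : x.1 = 0%MM -> x.2 \in memo st -> msig lts x = Some s ->
  syzygy_sig s.
Proof.
move=> x1 Rx2 sig_x; case/orP: crit_x => [/(F5_syzygy_criterionP (F5_done_good inv))/(_ sig_x) //|].
rewrite rewritten_criterionE.
have -> : msig lts x = SIG x.2 by rewrite [x in LHS]surjective_pairing x1 msig0.
by rewrite (first_rule_self (F5_pairwise inv) Rx2) eqxx.
Qed.

Lemma F5_drop_invariant : F5_invariant (State (DONE st) (TODO st `\ x) (memo st) : F5state).
Proof.
split=> /=.
- exact: F5_done inv.
- by move=> y; rewrite !inE => /andP[_ /(F5_todo inv)].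
- move=> i; case: (F5_initials inv i) => [Ti|]; last by right.
  have [def_x|ne] := eqVneq (0%MM, initial_pair f i) x; last by left; rewrite !inE ne.
  right; have sig_x : msig lts x = Some (0%MM, i) by rewrite -def_x msig0 sig_initial.
  case/orP: crit_x => [/(F5_syzygy_criterionP (F5_done_good inv))/(_ sig_x)|]; first by left.
  rewrite rewritten_criterionE; case Er: (first_rule _ _) => [r|//].
  have [Rr] := first_rule_mem Er; rewrite sig_x.
  case sig_r: (SIG r) => [t|//] /= /sdvd_initial def_t ne_r; rewrite def_t in sig_r.
  have [_ [Dr|Tr|syz]] := F5_rules inv Rr; [by right; exists r| |by left; apply: syz].
  (* A waiting rule of signature E_i can only be the initial pair itself, against [ne_r]. *)
  have [[_ _ [u sig_u ok_r]] _] := F5_todo inv Tr.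
  move: sig_u ok_r; rewrite value0 sig_r => -[<-] [[j def_r]|[]]; last by rewrite eqxx.
  move: sig_r ne_r; rewrite def_r sig_initial => -[->].
  by rewrite -def_x /= eqxx.
- move=> g h y Dg Dh jp_y; case: (F5_jpairs inv Dg Dh jp_y) => [Ty|[Ty Ry]|syz|rw].
  + have [eq_yx|ne] := eqVneq y x; last by constructor 1; rewrite !inE ne.
    rewrite eq_yx; case/orP: crit_x => [crit|]; last by constructor 4.
    by constructor 3 => t; apply: F5_syzygy_criterionP (F5_done_good inv) crit.
  + have [def_x|ne] := eqVneq (0%MM, value y) x; last by constructor 2; rewrite !inE ne.
    constructor 3 => t sig_y; apply: F5_drop_syzygy; rewrite -def_x //.
    by rewrite msig0.
  + by constructor 3.
  by constructor 4.
- exact: F5_pairwise inv.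
- by move=> r y Rr; rewrite !inE => /andP[_]; apply: F5_rules_le Rr.
- move=> r Rr; have [nN ok_r] := F5_rules inv Rr; split=> //.
  case: ok_r => [Dr|Tr|syz]; [by constructor 1| |by constructor 3].
  have [def_x|ne] := eqVneq (0%MM, r) x; last by constructor 2; rewrite !inE ne.
  constructor 3 => t sig_r; apply: F5_drop_syzygy; rewrite -def_x //.
  by rewrite msig0.
by move=> y; rewrite in_fsetD1 => /andP[_]; apply: F5_fresh.
Qed.

End Drop.

(** * Storing a reduced pair *)

Section Store.
Variables (st : F5state) (p q : pair).
Hypotheses (inv : F5_invariant st) (Tp : (0%MM, p) \in TODO st) (Rp : p \in memo st).
Hypothesis min_p : F5_min st (0%MM, p).
Hypotheses (good_q : good_pair q) (hom_q : homog_pair q) (sig_q : SIG q = SIG p).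
Notation R := (memo st).
Let swap_rule r := if r == p then q else r.

(** Both are the first divisor of the same signature. *)
Lemma F5_rule_same_sig r : r \in R -> SIG r = SIG p -> r = p.
Proof.
move=> Rr sig_r; have := first_rule_self (F5_pairwise inv) Rr.
by rewrite sig_r (first_rule_self (F5_pairwise inv) Rp) => -[].
Qed.

Lemma F5_p_fresh : p \notin DONE st.
Proof. by have := F5_fresh inv Tp; apply. Qed.

Lemma F5_q_fresh : q \notin DONE st.
Proof.
apply/negP => Dq; have [_ _ Rq] := F5_done inv Dq.
by have := F5_p_fresh; rewrite -(F5_rule_same_sig Rq sig_q) Dq.
Qed.

Lemma sig_swap_rule r : SIG (swap_rule r) = SIG r.
Proof. by rewrite /swap_rule; case: eqP => [->|]. Qed.

Lemma swap_rule_id r : r != p -> swap_rule r = r.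
Proof. by rewrite /swap_rule => /negPf->. Qed.

Lemma swap_rule_in r : r != p -> r \in R -> r \in map swap_rule R.
Proof. by move=> ne Rr; rewrite -(swap_rule_id ne); apply: map_f. Qed.

Lemma swap_rule_new : q \in map swap_rule R.
Proof. by apply/mapP; exists p => //; rewrite /swap_rule eqxx. Qed.

Lemma swap_rule_no_earlier_divisor : no_earlier_divisor (map swap_rule R).
Proof.
rewrite /no_earlier_divisor pairwise_map.
apply: sub_pairwise (F5_pairwise inv) => r r' /=; rewrite !sig_swap_rule.
by move=> /implyP imp; apply/implyP => /imp/eqP->.
Qed.

(** Signatures and positions are unchanged by the swap, and [q], not being in the old DONE, differs
    from [y.2]. *)
Lemma swap_rule_rewritten y : y.2 \in DONE st ->
  rewritten_criterion lts R y -> rewritten_criterion lts (map swap_rule R) y.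
Proof.
move=> Dy; rewrite !rewritten_criterionE first_rule_map => [|r _]; last exact: sig_swap_rule.
case: (first_rule R _) => //= r ne_r; rewrite /swap_rule; case: ifP => // _.
by apply: contraNneq F5_q_fresh => <-.
Qed.

Let st' : F5state := State (q |` DONE st)
  ((TODO st `\ (0%MM, p)) `|` jpairs ltm lts q (DONE st)) (map swap_rule R).

Lemma F5_store_todo y : y \in TODO st -> y <> (0%MM, p) -> y \in TODO st'.
Proof. by move=> Ty /eqP ne; rewrite /= in_fsetU in_fsetD1 ne Ty. Qed.

Lemma F5_store_todo' y : y \in TODO st' -> [\/ y \in TODO st /\ y <> (0%MM, p) |
  exists2 h, h \in DONE st & jpair ltm lts q h = Some y].
Proof.
rewrite /= in_fsetU in_fsetD1 => /orP[/andP[/eqP]|/jpairs_out]; first by left.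
by right.
Qed.

Lemma F5_store_invariant : F5_invariant st'.
Proof.
have [[pair_p hom_p [s sig_p ok_p]] _] := F5_todo inv Tp.
rewrite value0 in pair_p hom_p sig_p ok_p.
have sub : {subset DONE st <= q |` DONE st} by move=> g; apply: fset1Ur.
have jp_q h y : h \in q |` DONE st -> jpair ltm lts q h = Some y -> y \in TODO st'.
  rewrite in_fset1U => /predU1P[->|Dh jp_y]; first by rewrite jpair_diag.
  by rewrite /= in_fsetU (jpairs_in Dh jp_y) orbT.
split.
- move=> g; rewrite in_fset1U => /predU1P[->|Dg]; first by split=> //; exact: swap_rule_new.
  have [good_g hom_g Rg] := F5_done inv Dg; split=> //; apply: swap_rule_in Rg.
  by apply: contraNneq F5_p_fresh => <-.
- move=> y /F5_store_todo'[[Ty ne_y]|[h Dh jp_y]].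
    have [val_y ok_y] := F5_todo inv Ty; split=> //.
    case: ok_y => [?|[nz /sub Dy]|[y1 Ry]]; [by constructor 1|by constructor 2|].
    constructor 3; split=> //; apply: swap_rule_in Ry; apply/eqP => y2; apply: ne_y.
    by rewrite [y]surjective_pairing y1 y2.
  have good_h := F5_done_good inv Dh; have [_ hom_h _] := F5_done inv Dh.
  have [or_y nz [r [_ pair_r red]] _] := jpairP good_q good_h jp_y.
  have good_y : good_pair y.2 by case: or_y => ->.
  have hom_y : homog_pair y.2 by case: or_y => ->.
  split; last by constructor 2; split=> //; case: or_y => ->; [exact: fset1U1|exact: sub].
  have [t sig_y] := good_sig good_y.
  split; [by apply: is_pair_scale; case: good_y | | exists (smul y.1 t)].
  + by rewrite [y]surjective_pairing; apply: homog_value.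
  + by rewrite sig_scaleX sig_y.
  right; split; last by exists r.
  by rewrite /= -mdeg_eq0 mdegD addn_eq0 mdeg_eq0 (negPf nz).
- move=> i; case: (F5_initials inv i) => [Ti|/(initial_handled_sub sub)]; last by right.
  have [def_p|ne] := eqVneq (initial_pair f i) p.
    right; right; exists q; first exact: fset1U1.
    by rewrite sig_q -def_p sig_initial.
  by left; apply: F5_store_todo => // -[/eqP]; rewrite (negPf ne).
- move=> g h y; rewrite in_fset1U => /predU1P[-> Dh jp_y|Dg].
    by constructor 1; apply: jp_q jp_y.
  rewrite in_fset1U => /predU1P[->|Dh jp_y].
    by rewrite jpairC => jp_y; constructor 1; apply: jp_q jp_y; apply: sub.
  have [or_y nz_y _ _] := jpairP (F5_done_good inv Dg) (F5_done_good inv Dh) jp_y.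
  have Dy : y.2 \in DONE st by case: or_y => ->.
  case: (F5_jpairs inv Dg Dh jp_y) => [Ty|[Ty Ry]|syz|rw].
  + constructor 1; apply: F5_store_todo => // def_y.
    by rewrite def_y eqxx in nz_y.
  + have [eq_vp|ne] := eqVneq (value y) p; last first.
      constructor 2; split; last exact: swap_rule_in.
      by apply: F5_store_todo => // -[] /eqP; rewrite -/(value y) (negPf ne).
    (* The J-pair with value [p] is the one now treated: [q] is the first rule dividing its
       signature, and is not its component because the cofactor differs from 1. *)
    constructor 4; rewrite rewritten_criterionE /msig eq_vp -sig_q.
    rewrite (first_rule_self swap_rule_no_earlier_divisor swap_rule_new); apply/eqP => y2.
    move/negP: nz_y; apply; apply/eqP; apply: (@sig_value_ne y s); first by rewrite /msig eq_vp.
    by rewrite y2 sig_q.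
  + by constructor 3.
  by constructor 4; apply: swap_rule_rewritten.
- exact: swap_rule_no_earlier_divisor.
- move=> _ y /mapP[r Rr ->] /F5_store_todo'[[Ty _]|[h Dh jp_y]]; rewrite sig_swap_rule.
    exact: F5_rules_le Rr Ty.
  have [_ _ _] := jpairP good_q (F5_done_good inv Dh) jp_y.
  (* All rules are at most [p], and new J-pairs have signatures above that of [q], which is the one
     of [p]. *)
  have := F5_rules_le inv Rr Tp; rewrite msig0 sig_q sig_p.
  case: (msig lts y) => [t|//] le_rs lt_st; apply: oF5_le_trans le_rs _.
  exact: lts_F5_le lt_st.
- move=> _ /mapP[r Rr ->]; rewrite sig_swap_rule; have [nN ok_r] := F5_rules inv Rr.
  split=> //; rewrite /swap_rule; have [_|ne] := eqVneq r p; first by constructor 1; exact: fset1U1.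
  case: ok_r => [/sub Dr|Tr|syz]; [by constructor 1| |by constructor 3].
  by constructor 2; apply: F5_store_todo => // -[] /eqP; rewrite (negPf ne).
move=> y /F5_store_todo'[[Ty ne_y] y1|[h Dh jp_y] y1]; last first.
  have [_] := jpairP good_q (F5_done_good inv Dh) jp_y.
  by rewrite y1 eqxx.
rewrite in_fset1U negb_or (F5_fresh inv Ty y1) andbT; apply/eqP => y2; apply: ne_y.
rewrite [y]surjective_pairing y1 y2; congr (_, _).
(* If [q] still waited with cofactor 1, it would coincide with [p]: as an initial pair of the same
   signature, or as a rule of the same signature. *)
have [_ [[i def_y]|[]|[_]]] := F5_todo inv Ty.
- move: y2; rewrite def_y /= => def_q; have := sig_q; rewrite -def_q sig_initial sig_p => -[def_s].
  case: ok_p => [[j def_p]|[]]; last by rewrite -def_s eqxx.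
  by move: sig_p; rewrite def_p sig_initial -def_s => -[->].
- by rewrite y1 eqxx.
by rewrite y2 => Rq; apply: F5_rule_same_sig.
Qed.

End Store.

Lemma F5_value_initial_or_reducible p : F5_value p -> initial_or_reducible p.
Proof. by case=> _ _ [s _ [init|[_ red]]]; [left | right]. Qed.

Lemma F5_step (st st' : F5state) : F5_invariant st -> step ltm lts (A := A) st st' ->
  F5_invariant st'.
Proof.
move=> inv; case=> [st1 x /= prep [Tx _] crit|st1 x q red_x blk|st1 x q red_x _] /=.
- by have [inv1 _] := F5_prepareP inv prep; apply: F5_drop_invariant.
- have [inv1 _ _ comp [_ irr_q _ _]] := F5_reduces inv red_x.
  case: red_x => _ [Tx _] _ _; have [val_x _] := F5_todo inv1 Tx.
  by case: (general_blocksN (F5_value_initial_or_reducible val_x) comp irr_q blk).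
have [inv1 [x1 Rx2] min_x comp [pair_q irr_q sig_q hom_q]] := F5_reduces inv red_x.
case: red_x => _ [Tx _] _ _; have [s sig_x] := F5_msig inv1 Tx.
have good_q : good_pair q by split; rewrite ?sig_q ?sig_x.
case: x x1 Rx2 min_x Tx sig_q {comp sig_x} => [m p] /= -> Rp min_p Tp.
by rewrite msig0 value0 => sig_q; apply: F5_store_invariant.
Qed.

Lemma F5_regular : regular_TRB_algorithm ltm lts f A.
Proof.
have inv_reachable (st : F5state) : reachable ltm lts f (A := A) st -> F5_invariant st.
  exact: (@reachable_ind A F5_invariant F5_invariant_initial F5_step).
split=> [st st1 x q /inv_reachable inv red_x|st /inv_reachable inv T0 p TRB_p].
  by have [_ _ _ comp [_ irr_q _ _]] := F5_reduces inv red_x.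
have [[pair_p nz_p _] _] := TRB_p; case sig_p: (SIG p) => [t|]; last first.
  by move/(pair_sig_None pair_p): sig_p nz_p; rewrite /nonsyzygy => ->; rewrite lm0.
apply: (TRB_pair_found (@earlier_irr st) (@earlier_trans st) (F5_done_good inv)
  (@below_down (TODO st)) (F5_B_initial inv) (F5_B_jpair inv) TRB_p sig_p).
by move=> y; rewrite T0.
Qed.

End F5.

End SignatureTheory.

(** * Admissibility and compatibility of the concrete signature orders *)

Section Orders.
Context {K : fieldType} {n d : nat}.
Variables (ltm : rel 'X_{1..n}) (f : 'I_d -> {mpoly K[n]}).
Hypothesis adm_m : admissible_mon ltm.

Lemma F5_order_admissible : admissible_smon (F5_order ltm : rel (smon n d)).
Proof.
case: (adm_m) => irr trans tot mono pos; split.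
- by move=> s; rewrite /F5_order ltnn irr andbF.
- move=> [b j] [a i] [c k]; rewrite /F5_order /=.
  case/orP=> [lt_ji|/andP[/eqP-> lt_ab]]; case/orP=> [lt_kj|/andP[/eqP<- lt_bc]].
  + by rewrite (ltn_trans lt_kj lt_ji).
  + by rewrite lt_ji.
  + by rewrite lt_kj.
  by rewrite eqxx (trans _ _ _ lt_ab lt_bc) orbT.
- move=> [a i] [b j]; rewrite /F5_order /= xpair_eqE negb_and.
  have [->|ne_ij _] := eqVneq i j; first by rewrite ltnn orbF; apply: tot.
  by move: ne_ij; rewrite -val_eqE neq_ltn => /orP[] ->; rewrite ?orbT.
- by move=> m [a i] [b j]; rewrite /F5_order /= => /orP[->//|/andP[-> /(mono m)->]]; rewrite orbT.
move=> m [a i] nz; rewrite /F5_order /= eqxx ltnn /=.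
by have := mono a _ _ (pos m nz); rewrite addm0 addmC.
Qed.

Lemma EF5_order_a_compat m1 m2 (i : 'I_d) : admissible_smon (EF5_order_a ltm f) ->
  ltm m1 m2 -> EF5_order_a ltm f (m1, i) (m2, i).
Proof.
move=> adm_s lt12; case Ea: (lm ltm (f i)) => [a|]; last first.
  (* For f_i = 0 distinct multiples of E_i are incomparable, which contradicts the totality of the
     assumed admissible order. *)
  have ne12 : (m1, i) != (m2, i).
    by apply: contraTneq lt12 => -[->]; rewrite (ltm_irr adm_m).
  case: adm_s => _ _ /(_ _ _ ne12) + _ _.
  by rewrite /EF5_order_a /= !(lm_mulX adm_m) Ea.
rewrite /EF5_order_a /= !(lm_mulX adm_m) Ea /=.
by rewrite ![(_ + a)%MM]addmC (ltm_add2l adm_m) lt12.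
Qed.

Lemma EF5_order_b_compat m1 m2 (i : 'I_d) : homogeneous_order ltm ->
  ltm m1 m2 -> EF5_order_b ltm f (m1, i) (m2, i).
Proof.
move=> hom lt12; rewrite /EF5_order_b /= lt12 andbT.
(* For f_i = 0 both sizes are 0 and the tie is broken by [ltm]; otherwise the homogeneous order
   makes the size weakly increasing. *)
have [->|nz] := eqVneq (f i) 0; first by rewrite !mulr0 eqxx orbT.
have nzX m : 'X_[m] != 0 :> {mpoly K[n]} by rewrite -msize_poly_eq0 msizeX.
by rewrite !msizeM // !msizeX; have := ltm_mdeg adm_m hom lt12; lia.
Qed.

End Orders.

Theorem mainTheorem2 (K : fieldType) (n d : nat)
    (ltm : rel 'X_{1..n}) (f : 'I_d -> {mpoly K[n]}) :
  admissible_mon ltm ->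
  [/\ homogeneous_order ltm -> homogeneous_input f ->
        regular_TRB_algorithm ltm (F5_order ltm) f
          (TRB_F5 ltm (F5_order ltm) f),
      homogeneous_order ltm -> homogeneous_input f ->
        admissible_smon (EF5_order_a ltm f) ->
        regular_TRB_algorithm ltm (EF5_order_a ltm f) f
          (TRB_EF5 ltm (EF5_order_a ltm f) f),
      homogeneous_order ltm -> homogeneous_input f ->
        admissible_smon (EF5_order_b ltm f) ->
        regular_TRB_algorithm ltm (EF5_order_b ltm f) f
          (TRB_EF5 ltm (EF5_order_b ltm f) f)
    & forall lts : rel (smon n d), admissible_smon lts ->
        regular_TRB_algorithm ltm lts f (TRB_GVW ltm lts)].
Proof.
move=> adm_m; split.
- by move=> hom hom_f; apply: F5_regular => //; apply: F5_order_admissible.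
- by move=> hom _ adm_s; apply: EF5_regular => // m1 m2 i; apply: EF5_order_a_compat.
- by move=> hom _ adm_s; apply: EF5_regular => // m1 m2 i; apply: EF5_order_b_compat.
by move=> lts adm_s; apply: GVW_regular.
Qed.
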